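(* Let $\varphi:\mathbb{D}\to\mathbb{D}$ be analytic. Then the composition operator $C_\varphi$, $C_\varphi f=f\circ\varphi$, is a bounded linear operator on $H^2(\mathbb{D})$, and $$\|C_{\varphi}\|\leq \left\|\frac{\sqrt{1-|\varphi(0)|^2}}{1-\overline{\varphi(0)}\,\varphi}\right\|_\infty \leq \sqrt{\frac{1+|\varphi(0)|}{1-|\varphi(0)|}}.$$
   Context: $\mathbb{D}=\{z\in\mathbb{C}:|z|<1\}$. $H^2(\mathbb{D})$ is the Hardy space of analytic functions $f(z)=\sum_{n\ge 0}a_nz^n$ on $\mathbb{D}$ with $\|f\|^2=\sum_{n\ge0}|a_n|^2<\infty$; equivalently, the reproducing kernel Hilbert space on $\mathbb{D}$ with kernel $\frac{1}{1-z\overline{w}}$. $\|C_\varphi\|$ denotes the operator norm on $H^2(\mathbb{D})$. For an analytic function $\psi:\mathbb{D}\to\mathbb{C}$, $\|\psi\|_\infty=\sup_{z\in\mathbb{D}}|\psi(z)|$. The function inside the norm $\|\cdot\|_\infty$ is $z\mapsto \frac{\sqrt{1-|\varphi(0)|^2}}{1-\overline{\varphi(0)}\,\varphi(z)}$ on $\mathbb{D}$. *)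

(* Defs.v *)
From Stdlib Require Export Reals ClassicalEpsilon.
From Coquelicot Require Export Coquelicot.
Open Scope R_scope.

(* Functions on the unit disc are total functions [C -> C] of which only the
   values on the disc matter. *)
Definition in_disc (z : C) : Prop := Cmod z < 1.

Definition eq_on_disc (f g : C -> C) : Prop :=
  forall z : C, in_disc z -> f z = g z.

Definition analytic_on_disc (f : C -> C) : Prop :=
  forall z0 : C, in_disc z0 ->
  exists (r : posreal) (a : nat -> C),
    forall z : C, in_disc z -> Cmod (z - z0)%C < r ->
      @is_pseries C_AbsRing C_NormedModule a (z - z0)%C (f z).

Definition is_taylor (f : C -> C) (a : nat -> C) : Prop :=
  forall z : C, in_disc z -> @is_pseries C_AbsRing C_NormedModule a z (f z).

(* The expansion of [f] on the disc is unique when it exists, so the choice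
   below is determined by the values of [f] on the disc. *)
Definition taylor_coef (f : C -> C) : nat -> C :=
  epsilon (inhabits (fun _ : nat => RtoC 0)) (is_taylor f).

(* Analyticity of [f] is contained in [is_taylor f a]. *)
Definition in_H2 (f : C -> C) : Prop :=
  exists a : nat -> C,
    is_taylor f a /\ ex_series (fun n : nat => Cmod (a n) ^ 2).

(* Meaningful for [f] in H^2 only. *)
Definition H2_norm (f : C -> C) : R :=
  sqrt (Series (fun n : nat => Cmod (taylor_coef f n) ^ 2)).

Definition composition_op (phi : C -> C) (f : C -> C) : C -> C :=
  fun z => f (phi z).

(* The second clause says that [T] is well defined on H^2 as a space of
   functions on the disc. *)
Definition bounded_linear_on_H2 (T : (C -> C) -> (C -> C)) : Prop :=
  (forall f, in_H2 f -> in_H2 (T f)) /\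
  (forall f g, in_H2 f -> in_H2 g -> eq_on_disc f g -> eq_on_disc (T f) (T g)) /\
  (forall f g, in_H2 f -> in_H2 g ->
     eq_on_disc (T (fun z => f z + g z)%C) (fun z => T f z + T g z)%C) /\
  (forall (c : C) f, in_H2 f ->
     eq_on_disc (T (fun z => c * f z)%C) (fun z => c * T f z)%C) /\
  (exists K : R, forall f, in_H2 f -> H2_norm (T f) <= K * H2_norm f).

Definition H2_opnorm (T : (C -> C) -> (C -> C)) : Rbar :=
  Lub_Rbar (fun x : R =>
    exists f : C -> C, in_H2 f /\ H2_norm f <= 1 /\ x = H2_norm (T f)).

Definition sup_norm_disc (psi : C -> C) : Rbar :=
  Lub_Rbar (fun x : R => exists z : C, in_disc z /\ x = Cmod (psi z)).

(* Main.v *)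
Require Import Defs.
From Stdlib Require Import Lra Lia.

(** Write [a] for [phi 0], [k_w(z) = sqrt (1 - |w|^2) / (1 - conj w z)] for the
    normalised reproducing kernel at [w], and [m(z) = (a - z) / (1 - conj a z)]
    for the automorphism of the disc that exchanges [0] and [a].  The function
    in the middle of the inequality is [k_a o phi].

    The operator [U f = k_a (f o m)] is a contraction of H^2, and
    [psi = m o phi] fixes the origin, so that composition with [psi] is a
    contraction by Littlewood's subordination principle.  As [m] is an
    involution and [k_a (k_a o m) = 1],
    [f o phi = (k_a o phi) ((U f) o psi)], and the only factor that can increase
    the norm is the multiplication by [k_a o phi], which costs at most the
    supremum of its modulus.

    Both contractions are instances of [weighted_composition]: if [tau] maps the
    disc to itself and [tau w = 0], then [f |-> k_w (f o tau)] is a contraction.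
    Writing [f = f(0) + z g] gives
    [k_w (f o tau) = f(0) k_w + tau (k_w (g o tau))].  The second term vanishes at
    [w], hence is orthogonal to [k_w], and the multiplication by [tau] does not
    increase its norm; so the claim for polynomials follows by induction on the
    degree, and the general case by approximation.

    Multiplication is controlled by [disc_domination]: if [|F| <= |H|] on the disc,
    then the coefficients of [F] have the smaller sum of squares.  This rests on
    a discrete Parseval identity, the mean over the roots of unity of order
    [N + 1] of the squared modulus of a polynomial of degree at most [N] being the
    sum of the squared moduli of its coefficients, applied to partial sums on a
    circle of radius [r]; then [N] tends to infinity and [r] to 1.  The same
    averages give the Cauchy estimates and the uniqueness of expansions.

    Finally, analyticity is a local notion here, whereas membership in H^2 asks
    for one expansion valid on the whole disc.  [taylor_of_analytic] bridges the
    gap.  By compactness the local expansions around the points of a closed disc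
    share a radius [d] and coefficient bounds.  If the expansion at 0 represents
    the function on [|z| < r], the Cauchy estimates for its recentred
    coefficients, which are binomial multiples of the original ones, force it to
    converge beyond [r] by a margin depending on [d] only, and there it still
    represents the function; finitely many such steps reach any radius below 1. *)

(** * Finite sums and series of complex numbers *)

Notation csum := (@sum_n C_AbelianMonoid).
Notation rsum := (@sum_n R_AbelianMonoid).
Notation cseries := (@is_series C_AbsRing C_NormedModule).
Notation cpseries := (@is_pseries C_AbsRing C_NormedModule).

(** Sums over the canonical structures carry types such as [AbelianMonoid.sort
    C_AbelianMonoid], which [ring] and [field] do not identify with [C]. *)
Ltac Ceq := match goal with |- @eq _ ?x ?y => change (@eq C x y) end.
Ltac Rring := match goal with |- @eq _ ?x ?y => change (@eq R x y) end; ring.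
Ltac Cring := Ceq; ring.
Ltac Cfield := Ceq; field.

Lemma csum_S (u : nat -> C) n : csum u (S n) = (csum u n + u (S n))%C.
Proof. exact (@sum_Sn C_AbelianMonoid u n). Qed.

Lemma rsum_S (u : nat -> R) n : rsum u (S n) = rsum u n + u (S n).
Proof. exact (@sum_Sn R_AbelianMonoid u n). Qed.

Lemma csum_0 (u : nat -> C) : csum u 0 = u 0%nat.
Proof. exact (@sum_O C_AbelianMonoid u). Qed.

Lemma rsum_0 (u : nat -> R) : rsum u 0 = u 0%nat.
Proof. exact (@sum_O R_AbelianMonoid u). Qed.

Lemma csum_ext (u v : nat -> C) n :
  (forall k, (k <= n)%nat -> u k = v k) -> csum u n = csum v n.
Proof. apply (@sum_n_ext_loc C_AbelianMonoid). Qed.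

Lemma csum_plus (u v : nat -> C) n : csum (fun k => u k + v k)%C n = (csum u n + csum v n)%C.
Proof. exact (@sum_n_plus C_AbelianMonoid u v n). Qed.

Lemma csum_scal c (u : nat -> C) n : csum (fun k => c * u k)%C n = (c * csum u n)%C.
Proof. exact (@sum_n_mult_l C_Ring c u n). Qed.

Lemma rsum_scal c (u : nat -> R) n : rsum (fun k => c * u k) n = c * rsum u n.
Proof. exact (@sum_n_mult_l R_Ring c u n). Qed.

Lemma csum_switch (u : nat -> nat -> C) m n :
  csum (fun i => csum (u i) n) m = csum (fun j => csum (fun i => u i j) m) n.
Proof. exact (@sum_n_switch C_AbelianMonoid u m n). Qed.

Lemma csum_S_l (u : nat -> C) n :
  csum u (S n) = (u 0%nat + csum (fun k => u (S k)) n)%C.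
Proof.
  induction n as [|n IH]; [now rewrite csum_S, !csum_0|].
  rewrite csum_S, IH, csum_S; Cring.
Qed.

Lemma csum_mult (u v : nat -> C) n m :
  (csum u n * csum v m)%C = csum (fun i => csum (fun j => u i * v j)%C m) n.
Proof.
  rewrite Cmult_comm, <- csum_scal.
  apply csum_ext; intros i _; rewrite csum_scal; ring.
Qed.

Lemma csum_RtoC (u : nat -> R) n : csum (fun k => RtoC (u k)) n = RtoC (rsum u n).
Proof.
  induction n as [|n IH]; [now rewrite csum_0, rsum_0|].
  now rewrite csum_S, rsum_S, IH, RtoC_plus.
Qed.

Lemma Cconj_RtoC x : Cconj (RtoC x) = RtoC x.
Proof. unfold Cconj, RtoC; simpl; f_equal; ring. Qed.

Lemma csum_conj (u : nat -> C) n : Cconj (csum u n) = csum (fun k => Cconj (u k)) n.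
Proof.
  induction n as [|n IH]; [now rewrite !csum_0|].
  now rewrite !csum_S, Cplus_conj, IH.
Qed.

Lemma rsum_le (u v : nat -> R) n :
  (forall k, (k <= n)%nat -> u k <= v k) -> rsum u n <= rsum v n.
Proof.
  induction n as [|n IH]; intros H.
  - rewrite !rsum_0; auto.
  - rewrite !rsum_S; apply Rplus_le_compat; auto.
Qed.

Lemma rsum_ge0 (u : nat -> R) n : (forall k, 0 <= u k) -> 0 <= rsum u n.
Proof.
  intros H; induction n as [|n IH]; [rewrite rsum_0 | rewrite rsum_S]; auto.
  apply Rplus_le_le_0_compat; auto.
Qed.

Lemma rsum_incr (u : nat -> R) n m :
  (forall k, 0 <= u k) -> (n <= m)%nat -> rsum u n <= rsum u m.
Proof.
  intros H Hnm; induction Hnm as [|m _ IH]; [lra|].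
  rewrite rsum_S; specialize (H (S m)); lra.
Qed.

Lemma term_le_rsum (u : nat -> R) k N :
  (forall n, 0 <= u n) -> (k <= N)%nat -> u k <= rsum u N.
Proof.
  intros H HkN; eapply Rle_trans; [|apply (rsum_incr u k N); auto].
  destruct k as [|k]; [rewrite rsum_0; lra|].
  rewrite rsum_S; pose proof (rsum_ge0 u k H); lra.
Qed.

Lemma Cmod_csum_le (u : nat -> C) n : Cmod (csum u n) <= rsum (fun k => Cmod (u k)) n.
Proof.
  induction n as [|n IH]; [rewrite csum_0, rsum_0; lra|].
  rewrite csum_S, rsum_S.
  eapply Rle_trans; [apply Cmod_triangle | lra].
Qed.

Lemma Cmod_minus_sym x y : Cmod (x - y) = Cmod (y - x).
Proof. replace (x - y)%C with (- (y - x))%C by ring; apply Cmod_opp. Qed.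

Lemma Cmod_le_0 x : Cmod x <= 0 -> x = 0.
Proof. intros H; apply Cmod_eq_0, Rle_antisym; [exact H | apply Cmod_ge_0]. Qed.

Lemma Cmod_RtoC_pos x : 0 <= x -> Cmod (RtoC x) = x.
Proof. intros H; rewrite Cmod_R; now apply Rabs_pos_eq. Qed.

Lemma Cmod_sqr x : Cmod x ^ 2 = fst x ^ 2 + snd x ^ 2.
Proof.
  unfold Cmod; rewrite pow2_sqrt; [reflexivity|].
  pose proof (pow2_ge_0 (fst x)); pose proof (pow2_ge_0 (snd x)); lra.
Qed.

Lemma Cmod_le_re_im (x : C) : Cmod x <= Rabs (fst x) + Rabs (snd x).
Proof.
  replace x with (RtoC (fst x) + Ci * RtoC (snd x))%C at 1
    by (destruct x; unfold Cplus, Cmult, Ci, RtoC; simpl; f_equal; ring).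
  eapply Rle_trans; [apply Cmod_triangle|].
  rewrite Cmod_mult, !Cmod_R, Cmod_Ci; lra.
Qed.

Lemma is_lim_seq_plus0 u v :
  is_lim_seq u 0 -> is_lim_seq v 0 -> is_lim_seq (fun n => u n + v n) 0.
Proof.
  intros Hu Hv.
  replace (Finite 0) with (Finite (0 + 0)) by (f_equal; ring).
  apply is_lim_seq_plus'; auto.
Qed.

Lemma is_lim_seq_0_squeeze (u v : nat -> R) :
  (forall n, 0 <= u n <= v n) -> is_lim_seq v 0 -> is_lim_seq u 0.
Proof.
  intros H Hv; apply (is_lim_seq_le_le (fun _ => 0) u v); auto; apply is_lim_seq_const.
Qed.

(** Bounds on limits are obtained throughout in the form of a bound up to an
    error that tends to 0. *)
Lemma le_add_lim0 x y (e : nat -> R) N :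
  is_lim_seq e 0 -> (forall n, (N <= n)%nat -> x <= y + e n) -> x <= y.
Proof.
  intros He H.
  assert (L : Rbar_le x (y + 0)).
  { apply (is_lim_seq_le_loc (fun _ => x) (fun n => y + e n)).
    - exists N; exact H.
    - apply is_lim_seq_const.
    - apply (is_lim_seq_plus' _ _ y 0); [apply is_lim_seq_const | exact He]. }
  simpl in L; lra.
Qed.

Lemma cseries_lim (u : nat -> C) (l : C) :
  cseries u l <-> is_lim_seq (fun n => Cmod (csum u n - l)) 0.
Proof.
  split; intros H.
  - apply is_lim_seq_spec; intros eps.
    apply (proj1 (filterlim_locally_ball_norm _ _)) with (eps := eps) in H.
    revert H; apply filter_imp; intros n Hn.
    unfold ball_norm in Hn; rewrite Rminus_0_r, Rabs_pos_eq by apply Cmod_ge_0.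
    exact Hn.
  - apply filterlim_locally_ball_norm; intros eps.
    apply is_lim_seq_spec in H; specialize (H eps).
    revert H; apply filter_imp; intros n Hn.
    rewrite Rminus_0_r, Rabs_pos_eq in Hn by apply Cmod_ge_0.
    exact Hn.
Qed.

Lemma cseries_unique (u : nat -> C) (l l' : C) : cseries u l -> cseries u l' -> l = l'.
Proof.
  intros H H'; apply cseries_lim in H; apply cseries_lim in H'.
  assert (E : (l - l')%C = 0).
  { apply Cmod_le_0.
    apply (le_add_lim0 _ _ _ 0 (is_lim_seq_plus0 _ _ H H')).
    intros n _; rewrite (Cmod_minus_sym (csum u n) l), Rplus_0_l.
    replace (l - l')%C with ((l - csum u n) + (csum u n - l'))%C by ring.
    apply Cmod_triangle. }
  replace l with ((l - l') + l')%C by ring; rewrite E; ring.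
Qed.

Lemma cseries_ext (u v : nat -> C) (l : C) : (forall n, u n = v n) -> cseries u l -> cseries v l.
Proof. apply is_series_ext. Qed.

Lemma cseries_plus (u v : nat -> C) (l m : C) :
  cseries u l -> cseries v m -> cseries (fun n => u n + v n)%C (l + m)%C.
Proof. exact (@is_series_plus C_AbsRing C_NormedModule u v l m). Qed.

Lemma cseries_scal (c : C) (u : nat -> C) (l : C) :
  cseries u l -> cseries (fun n => c * u n)%C (c * l)%C.
Proof. exact (@is_series_scal C_AbsRing C_NormedModule c u l). Qed.

Lemma cseries_abs (u : nat -> C) (v : nat -> R) :
  (forall n, Cmod (u n) <= v n) -> ex_series v -> exists l : C, cseries u l.
Proof. exact (@ex_series_le C_AbsRing C_CompleteNormedModule u v). Qed.

Lemma cseries_csum (u : nat -> nat -> C) (col : nat -> C) L :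
  (forall n, cseries (fun m => u m n) (col n)) ->
  cseries (fun m => csum (u m) L) (csum col L).
Proof.
  intros H; induction L as [|L IH].
  - rewrite csum_0; apply (cseries_ext (fun m => u m 0%nat)); auto.
    intros; now rewrite csum_0.
  - rewrite csum_S.
    apply (cseries_ext (fun m => csum (u m) L + u m (S L))%C).
    + intros; now rewrite csum_S.
    + now apply cseries_plus.
Qed.

Lemma cseries_finite (u : nat -> C) N :
  (forall n, (N < n)%nat -> u n = RtoC 0) -> cseries u (csum u N).
Proof.
  intros Z; apply cseries_lim.
  apply (is_lim_seq_ext_loc (fun _ => 0)); [|apply is_lim_seq_const].
  exists N; intros n Hn.
  assert (E : csum u n = csum u N).
  { induction Hn as [|n Hn IH]; [reflexivity|].
    rewrite csum_S, IH, Z by lia; Cring. }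
  rewrite E; replace (_ - _)%C with (RtoC 0) by ring; now rewrite Cmod_0.
Qed.

Lemma cseries_bounded (u : nat -> C) (l : C) :
  cseries u l -> exists K, forall n, Cmod (u n) <= K.
Proof.
  intros H; apply cseries_lim, is_lim_seq_spec in H.
  destruct (H (mkposreal 1 Rlt_0_1)) as [N HN]; simpl in HN.
  assert (S0 := rsum_ge0 (fun n => Cmod (u n)) (S N) (fun n => Cmod_ge_0 _)).
  exists (2 + rsum (fun n => Cmod (u n)) (S N)); intros n.
  destruct (Nat.le_gt_cases n (S N)) as [L|L].
  - pose proof (term_le_rsum (fun n => Cmod (u n)) n (S N) (fun n => Cmod_ge_0 _) L).
    simpl in *; lra.
  - destruct n as [|n]; [lia|].
    pose proof (HN n ltac:(lia)) as H1; pose proof (HN (S n) ltac:(lia)) as H2.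
    rewrite Rminus_0_r, Rabs_pos_eq in H1, H2 by apply Cmod_ge_0.
    rewrite csum_S in H2.
    replace (u (S n)) with ((csum u n + u (S n) - l) + - (csum u n - l))%C by ring.
    eapply Rle_trans; [apply Cmod_triangle|]; rewrite Cmod_opp; lra.
Qed.

(** Gives the columns of the array of a Cauchy product. *)
Lemma cseries_shift (v : nat -> C) (l : C) n :
  cseries v l -> cseries (fun k => if Nat.leb n k then v (k - n)%nat else RtoC 0) l.
Proof.
  intros H; induction n as [|n IH].
  - revert H; apply cseries_ext; intros k; simpl; now rewrite Nat.sub_0_r.
  - apply (@is_series_decr_1 C_AbsRing C_NormedModule); simpl.
    replace (plus _ _) with l; [exact IH|].
    change (l = (l + - RtoC 0)%C); ring.
Qed.

Lemma rseries_lim (u : nat -> R) : ex_series u -> is_lim_seq (rsum u) (Series u).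
Proof. intros H; exact (Series_correct u H). Qed.

Lemma rsum_le_Series (u : nat -> R) n :
  (forall k, 0 <= u k) -> ex_series u -> rsum u n <= Series u.
Proof.
  intros H E.
  apply (is_lim_seq_incr_compare (rsum u)); [apply rseries_lim; auto|].
  intros k; rewrite rsum_S; specialize (H (S k)); lra.
Qed.

Lemma term_le_Series (u : nat -> R) k :
  (forall n, 0 <= u n) -> ex_series u -> u k <= Series u.
Proof.
  intros H E; eapply Rle_trans; [apply (term_le_rsum u k k); auto|].
  apply rsum_le_Series; auto.
Qed.

Lemma ex_series_bounded (u : nat -> R) B :
  (forall k, 0 <= u k) -> (forall n, rsum u n <= B) ->
  ex_series u /\ Series u <= B.
Proof.
  intros H HB.
  destruct (ex_finite_lim_seq_incr (rsum u) B) as [l Hl]; auto.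
  { intros k; rewrite rsum_S; specialize (H (S k)); lra. }
  assert (E : is_series u l) by exact Hl.
  split; [exists l; auto|].
  rewrite (is_series_unique _ _ E).
  apply (is_lim_seq_le (rsum u) (fun _ => B) l B); auto.
  apply is_lim_seq_const.
Qed.

Lemma ex_series_le_pos (u v : nat -> R) :
  (forall n, 0 <= u n <= v n) -> ex_series v -> ex_series u.
Proof.
  intros H; apply (@ex_series_le R_AbsRing R_CompleteNormedModule).
  intros n; change (Rabs (u n) <= v n); rewrite Rabs_pos_eq; apply H.
Qed.

Lemma ex_series_scaled_geom K q :
  0 <= q < 1 -> ex_series (fun n => K * q ^ n) /\
  Series (fun n => K * q ^ n) = K / (1 - q).
Proof.
  intros Hq.
  assert (H : is_series (fun n => K * q ^ n) (K * / (1 - q))).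
  { apply (@is_series_scal R_AbsRing R_NormedModule), is_series_geom.
    rewrite Rabs_pos_eq; lra. }
  split; [eexists; exact H | exact (is_series_unique _ _ H)].
Qed.

Lemma ratio_lt_1 r t : 0 <= r < t -> 0 <= r / t < 1.
Proof.
  intros H; split.
  - apply Rmult_le_pos; [lra | apply Rlt_le, Rinv_0_lt_compat; lra].
  - apply (Rmult_lt_reg_r t); [lra|].
    replace (r / t * t) with r by (field; lra); lra.
Qed.

Lemma Series_ge0 (u : nat -> R) :
  (forall k, 0 <= u k) -> ex_series u -> 0 <= Series u.
Proof.
  intros H E; eapply Rle_trans; [apply (rsum_ge0 u 0%nat H)|].
  apply rsum_le_Series; auto.
Qed.

Lemma Series_tail_lim0 (u : nat -> R) :
  ex_series u -> is_lim_seq (fun n => Series u - rsum u n) 0.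
Proof.
  intros E; replace (Finite 0) with (Finite (Series u - Series u)) by (f_equal; ring).
  apply is_lim_seq_minus'; [apply is_lim_seq_const | apply rseries_lim, E].
Qed.

Lemma cseries_tail_le (u : nat -> C) (v : nat -> R) (l : C) N :
  (forall n, 0 <= v n) -> (forall n, (N < n)%nat -> Cmod (u n) <= v n) ->
  ex_series v -> cseries u l -> Cmod (csum u N - l) <= Series v - rsum v N.
Proof.
  intros v0 B E H.
  assert (P : forall M, (N <= M)%nat ->
    Cmod (csum u N - csum u M) <= rsum v M - rsum v N).
  { intros M HM; induction HM as [|M HM IH].
    - replace (_ - _)%C with (RtoC 0) by ring; rewrite Cmod_0; lra.
    - rewrite csum_S, rsum_S.
      replace (csum u N - (csum u M + u (S M)))%C
        with ((csum u N - csum u M) + - u (S M))%C by ring.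
      eapply Rle_trans; [apply Cmod_triangle|]; rewrite Cmod_opp.
      specialize (B (S M)); assert (N < S M)%nat by lia; intuition lra. }
  apply cseries_lim in H.
  apply (le_add_lim0 _ _ _ N H); intros M HM.
  replace (csum u N - l)%C with ((csum u N - csum u M) + (csum u M - l))%C by ring.
  eapply Rle_trans; [apply Cmod_triangle|].
  apply Rplus_le_compat_r; eapply Rle_trans; [apply P, HM|].
  apply Rplus_le_compat_r, rsum_le_Series; auto.
Qed.

Lemma cseries_norm_le (u : nat -> C) (v : nat -> R) (l : C) :
  (forall n, Cmod (u n) <= v n) -> ex_series v -> cseries u l ->
  Cmod l <= Series v.
Proof.
  intros B E H.
  assert (v0 : forall n, 0 <= v n).
  { intros n; eapply Rle_trans; [apply Cmod_ge_0 | apply B]. }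
  assert (T := cseries_tail_le u v l 0 v0 (fun n _ => B n) E H).
  rewrite csum_0, rsum_0, Cmod_minus_sym in T.
  specialize (B 0%nat).
  replace l with ((l - u 0%nat) + u 0%nat)%C by ring.
  eapply Rle_trans; [apply Cmod_triangle | lra].
Qed.

Lemma ex_series_sq (h : nat -> C) :
  ex_series (fun n => Cmod (h n)) -> ex_series (fun n => Cmod (h n) ^ 2).
Proof.
  intros E.
  assert (B : forall n, Cmod (h n) <= Series (fun n => Cmod (h n))).
  { intros n; apply (term_le_Series (fun n => Cmod (h n))); auto using Cmod_ge_0. }
  apply (@ex_series_le R_AbsRing R_CompleteNormedModule _
           (fun n => Series (fun n => Cmod (h n)) * Cmod (h n))).
  - intros n; change (Rabs (Cmod (h n) ^ 2) <= Series (fun n => Cmod (h n)) * Cmod (h n)).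
    rewrite Rabs_pos_eq by apply pow2_ge_0.
    specialize (B n); pose proof (Cmod_ge_0 (h n)); nra.
  - apply (@ex_series_scal R_AbsRing R_NormedModule), E.
Qed.

Lemma complex_cauchy_lim (x : nat -> C) (e : nat -> R) :
  is_lim_seq e 0 -> (forall N M, (N <= M)%nat -> Cmod (x M - x N) <= e N) ->
  exists l, is_lim_seq (fun n => Cmod (x n - l)) 0.
Proof.
  intros He H.
  assert (Real : forall p : C -> R,
    (forall n m, Rabs (p (x n) - p (x m)) <= Cmod (x n - x m)) ->
    exists l : R, is_lim_seq (fun n => Rabs (p (x n) - l)) 0).
  { intros p Hp.
    destruct (proj2 (ex_lim_seq_cauchy_corr (fun n => p (x n)))) as [l Hl].
    - intros eps; apply is_lim_seq_spec in He; destruct (He (pos_div_2 eps)) as [N HN].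
      exists N; intros n m Hn Hm.
      assert (EN : e N < eps / 2).
      { specialize (HN N (Nat.le_refl N)); rewrite Rminus_0_r in HN.
        eapply Rle_lt_trans; [apply Rle_abs | exact HN]. }
      eapply Rle_lt_trans; [apply Hp|].
      replace (x n - x m)%C with ((x n - x N) + - (x m - x N))%C by ring.
      eapply Rle_lt_trans; [apply Cmod_triangle|]; rewrite Cmod_opp.
      pose proof (H N n Hn); pose proof (H N m Hm); lra.
    - exists l.
      replace (Finite 0) with (Rbar_abs (Finite 0)) by (simpl; now rewrite Rabs_R0).
      apply (is_lim_seq_abs (fun n => p (x n) - l) 0).
      replace (Finite 0) with (Finite (l - l)) by (f_equal; ring).
      apply is_lim_seq_minus'; [exact Hl | apply is_lim_seq_const]. }
  destruct (Real fst) as [l1 H1].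
  { intros n m; change (fst (x n) - fst (x m)) with (fst (x n - x m)%C).
    eapply Rle_trans; [apply Rmax_l | apply Rmax_Cmod]. }
  destruct (Real snd) as [l2 H2].
  { intros n m; change (snd (x n) - snd (x m)) with (snd (x n - x m)%C).
    eapply Rle_trans; [apply Rmax_r | apply Rmax_Cmod]. }
  exists (l1, l2).
  apply (is_lim_seq_0_squeeze _ _ (fun n => conj (Cmod_ge_0 _) (Cmod_le_re_im _))).
  exact (is_lim_seq_plus0 _ _ H1 H2).
Qed.

(** * Interchanging the summations of a triangular array *)

(** The entries above the diagonal vanish, so the square partial sum of the
    array is its triangular one. *)
Lemma csum_triangle_swap (u : nat -> nat -> C) n :
  (forall m k, (m < k)%nat -> u m k = RtoC 0) ->
  csum (fun m => csum (u m) n) n = csum (fun m => csum (u m) m) n.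
Proof.
  intros Z; apply (@sum_n_ext_loc C_AbelianMonoid); intros m Hm.
  induction Hm as [|k Hk IH]; [reflexivity|].
  rewrite csum_S, IH, Z by lia. apply Cplus_0_r.
Qed.

(** The sum of the first [L] rows is the square partial sum, and it differs
    from the sum of the first [L] columns by entries in the rows beyond [L],
    whose total is at most the tail of [rho]. *)
Lemma triangular_fubini_bound (u : nat -> nat -> C) (rho : nat -> R) (col : nat -> C) L :
  (forall m n, (m < n)%nat -> u m n = RtoC 0) ->
  (forall m, rsum (fun n => Cmod (u m n)) m <= rho m) -> ex_series rho ->
  (forall n, cseries (fun m => u m n) (col n)) ->
  Cmod (csum (fun m => csum (u m) m) L - csum col L) <= Series rho - rsum rho L.
Proof.
  intros Z B E H.
  assert (rho0 : forall m, 0 <= rho m).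
  { intros m; eapply Rle_trans; [|apply B].
    apply rsum_ge0; intros; apply Cmod_ge_0. }
  assert (Bd : forall m, (L <= m)%nat -> Cmod (csum (u m) L) <= rho m).
  { intros m Hm; eapply Rle_trans; [apply Cmod_csum_le|].
    eapply Rle_trans; [|apply B].
    apply rsum_incr; auto; intros; apply Cmod_ge_0. }
  rewrite <- csum_triangle_swap by exact Z.
  apply (cseries_tail_le (fun m => csum (u m) L)); auto.
  - intros m Hm; apply Bd; lia.
  - apply cseries_csum, H.
Qed.

(** Both the Cauchy product and the recentring of a power series are
    interchanges of this kind: the rows are finite sums, and the columns are
    series. *)
Lemma triangular_fubini (u : nat -> nat -> C) (rho : nat -> R) (col : nat -> C) (l : C) :
  (forall m n, (m < n)%nat -> u m n = RtoC 0) ->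
  (forall m, rsum (fun n => Cmod (u m n)) m <= rho m) -> ex_series rho ->
  (forall n, cseries (fun m => u m n) (col n)) ->
  cseries (fun m => csum (u m) m) l <-> cseries col l.
Proof.
  intros Z B E H; rewrite !cseries_lim.
  pose proof (fun L => triangular_fubini_bound u rho col L Z B E H) as D.
  assert (K : forall v w : nat -> C,
    (forall L, Cmod (v L - w L) <= Series rho - rsum rho L) ->
    is_lim_seq (fun n => Cmod (v n - l)) 0 ->
    is_lim_seq (fun n => Cmod (w n - l)) 0).
  { intros v w Dvw Hv.
    apply (is_lim_seq_le_le (fun _ => 0) _
             (fun n => (Series rho - rsum rho n) + Cmod (v n - l))).
    - intros n; split; [apply Cmod_ge_0|].
      replace (w n - l)%C with (- (v n - w n) + (v n - l))%C by ring.
      eapply Rle_trans; [apply Cmod_triangle|]; rewrite Cmod_opp.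
      apply Rplus_le_compat_r, Dvw.
    - apply is_lim_seq_const.
    - apply is_lim_seq_plus0; auto; apply Series_tail_lim0, E. }
  split; apply K; auto.
  intros L; rewrite Cmod_minus_sym; auto.
Qed.

(** * Power series *)

Lemma cpseries_cseries (a : nat -> C) (z l : C) :
  cpseries a z l <-> cseries (fun n => z ^ n * a n)%C l.
Proof. reflexivity. Qed.

Lemma cpseries_bounded (a : nat -> C) (z l : C) :
  cpseries a z l -> exists K, forall n, Cmod (a n) * Cmod z ^ n <= K.
Proof.
  intros H; apply cpseries_cseries, cseries_bounded in H; destruct H as [K H].
  exists K; intros n; specialize (H n).
  rewrite Cmod_mult, Cmod_pow in H; lra.
Qed.

Lemma geom_domination (a : nat -> C) K t r :
  (forall n, Cmod (a n) * t ^ n <= K) -> 0 <= r < t ->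
  forall n, Cmod (a n) * r ^ n <= K * (r / t) ^ n.
Proof.
  intros H Hr n.
  assert (T : 0 < t ^ n) by (apply pow_lt; lra).
  assert (rt : 0 <= r / t).
  { apply Rmult_le_pos; [lra | apply Rlt_le, Rinv_0_lt_compat; lra]. }
  replace (r ^ n) with (t ^ n * (r / t) ^ n).
  - rewrite <- Rmult_assoc; apply Rmult_le_compat_r; [now apply pow_le | apply H].
  - rewrite <- Rpow_mult_distr; f_equal; field; lra.
Qed.

Lemma abs_conv_of_bounded (a : nat -> C) K t r :
  (forall n, Cmod (a n) * t ^ n <= K) -> 0 <= r < t ->
  ex_series (fun n => Cmod (a n) * r ^ n).
Proof.
  intros H Hr.
  apply (ex_series_le_pos _ (fun n => K * (r / t) ^ n)).
  - intros n; split; [|now apply geom_domination].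
    apply Rmult_le_pos; [apply Cmod_ge_0 | apply pow_le; lra].
  - apply ex_series_scaled_geom, ratio_lt_1, Hr.
Qed.

Lemma cpseries_abs_conv (a : nat -> C) (z l : C) r :
  cpseries a z l -> 0 <= r < Cmod z -> ex_series (fun n => Cmod (a n) * r ^ n).
Proof.
  intros H Hr; destruct (cpseries_bounded _ _ _ H) as [K HK].
  now apply (abs_conv_of_bounded a K (Cmod z)).
Qed.

Lemma cpseries_ex (a : nat -> C) (z : C) :
  ex_series (fun n => Cmod (a n) * Cmod z ^ n) -> exists l : C, cpseries a z l.
Proof.
  intros E; apply (cseries_abs (fun n => z ^ n * a n)%C _) in E; [exact E|].
  intros n; rewrite Cmod_mult, Cmod_pow; lra.
Qed.

Lemma cpseries_minus (a b : nat -> C) (z l m : C) :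
  cpseries a z l -> cpseries b z m -> cpseries (fun n => a n - b n)%C z (l - m)%C.
Proof.
  rewrite !cpseries_cseries; intros Ha Hb.
  apply (cseries_scal (RtoC (-1))) in Hb.
  replace (l - m)%C with (l + RtoC (-1) * m)%C by ring.
  apply (cseries_ext (fun n => z ^ n * a n + RtoC (-1) * (z ^ n * b n))%C).
  - intros n; ring.
  - now apply cseries_plus.
Qed.

Definition const_coef (c : C) (n : nat) : C :=
  match n with O => c | S _ => RtoC 0 end.

Lemma cpseries_const (c z : C) : cpseries (const_coef c) z c.
Proof.
  apply cpseries_cseries.
  assert (H : cseries (fun n => z ^ n * const_coef c n)%C
                (csum (fun n => z ^ n * const_coef c n)%C 0)).
  { apply cseries_finite; intros [|n] Hn; [lia | simpl; ring]. }
  rewrite csum_0 in H; simpl in H.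
  now replace (1 * c)%C with c in H by ring.
Qed.

(** Allows a bound by a constant to be treated as a domination by a power
    series. *)
Lemma const_coef_sums (c : C) :
  ex_series (fun n => Cmod (const_coef c n)) /\
  ex_series (fun n => Cmod (const_coef c n) ^ 2) /\
  Series (fun n => Cmod (const_coef c n) ^ 2) <= Cmod c ^ 2.
Proof.
  assert (E : ex_series (fun n => Cmod (const_coef c n))).
  { apply (ex_series_bounded _ (Cmod c)); auto using Cmod_ge_0.
    induction n as [|n IH]; [rewrite rsum_0; simpl; lra|].
    rewrite rsum_S; simpl; rewrite Cmod_0; lra. }
  split; [exact E|].
  apply (ex_series_bounded _ (Cmod c ^ 2)); auto using pow2_ge_0.
  induction n as [|n IH]; [rewrite rsum_0; simpl; lra|].
  rewrite rsum_S; simpl const_coef; rewrite Cmod_0; lra.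
Qed.

(** * Averages over roots of unity *)

Lemma unit_root_pow t k : ((cos t, sin t) ^ k)%C = (cos (INR k * t), sin (INR k * t)).
Proof.
  induction k as [|k IH].
  - simpl; rewrite Rmult_0_l, cos_0, sin_0; reflexivity.
  - rewrite Cpow_S, IH, S_INR, Rmult_plus_distr_r, Rmult_1_l, cos_plus, sin_plus.
    unfold Cmult; simpl; f_equal; ring.
Qed.

Lemma primitive_root_ex N : exists w : C,
  Cmod w = 1 /\ (w ^ S N)%C = 1 /\
  forall j, (0 < j <= N)%nat -> (w ^ j)%C <> 1.
Proof.
  set (t := 2 * PI / INR (S N)).
  assert (Hpos : 0 < INR (S N)) by (apply lt_0_INR; lia).
  assert (Ht : INR (S N) * t = 2 * PI) by (unfold t; field; lra).
  pose proof PI_RGT_0 as Hpi.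
  assert (tpos : 0 < t).
  { unfold t; apply Rdiv_lt_0_compat; lra. }
  exists (cos t, sin t); split; [|split].
  - unfold Cmod; simpl fst; simpl snd.
    replace (cos t ^ 2 + sin t ^ 2) with 1; [apply sqrt_1|].
    pose proof (sin2_cos2 t) as Q; unfold Rsqr in Q; nra.
  - rewrite unit_root_pow, Ht, cos_2PI, sin_2PI; reflexivity.
  - intros j [Hj1 Hj2] E; rewrite unit_root_pow in E.
    assert (Ec : cos (INR j * t) = 1) by (apply (f_equal fst) in E; exact E).
    assert (H0 : 0 < INR j) by (apply lt_0_INR; lia).
    assert (H1 : INR j < INR (S N)) by (apply lt_INR; lia).
    (* the half angle lies strictly between 0 and PI *)
    assert (Hs : 0 < sin (INR j * t / 2)).
    { apply sin_gt_0; nra. }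
    replace (INR j * t) with (2 * (INR j * t / 2)) in Ec by field.
    rewrite cos_2a_sin in Ec; nra.
Qed.

(** Multiply by [x - 1] and telescope. *)
Lemma csum_geom_root x N : (x ^ S N)%C = 1 -> x <> 1 -> csum (fun k => x ^ k)%C N = RtoC 0.
Proof.
  intros Hx Hne.
  assert (T : forall n, (csum (fun k => x ^ k)%C n * (x - 1) = x ^ S n - 1)%C).
  { induction n as [|n IH]; [rewrite csum_0; simpl; ring|].
    rewrite csum_S, Cmult_plus_distr_r, IH, !Cpow_S; ring. }
  specialize (T N); rewrite Hx in T.
  assert (D : (x - 1)%C <> 0).
  { intros D; apply Hne; replace x with ((x - 1) + 1)%C by ring; rewrite D; ring. }
  replace (csum _ N) with ((csum (fun k => x ^ k)%C N * (x - 1)) / (x - 1))%C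
    by (field; exact D).
  rewrite T; Cfield; exact D.
Qed.

Lemma csum_delta (a : C) n N :
  (n <= N)%nat -> csum (fun m => if Nat.eqb n m then a else RtoC 0) N = a.
Proof.
  assert (Z : forall M, (M < n)%nat ->
    csum (fun m => if Nat.eqb n m then a else RtoC 0) M = RtoC 0).
  { induction M as [|M IH]; intros HM.
    - rewrite csum_0; destruct (Nat.eqb_spec n 0); [lia | reflexivity].
    - rewrite csum_S, IH by lia.
      destruct (Nat.eqb_spec n (S M)); [lia | Cring]. }
  induction N as [|N IH]; intros HN.
  - rewrite csum_0; destruct (Nat.eqb_spec n 0); [reflexivity | lia].
  - rewrite csum_S; destruct (Nat.eqb_spec n (S N)).
    + rewrite Z by lia; Cring.
    + rewrite IH by lia; Cring.
Qed.

Lemma unit_conj w k : Cmod w = 1 -> (w ^ k * Cconj w ^ k)%C = 1.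
Proof.
  intros H; rewrite <- Cpow_mult_l, <- Cmod2_conj, H.
  replace (1 ^ 2) with 1 by ring; apply Cpow_1_l.
Qed.

(** The sum is geometric with ratio [w^(n - m)], a root of unity different
    from 1 unless [n = m]. *)
Lemma root_orthogonality w N n m :
  Cmod w = 1 -> (w ^ S N)%C = 1 ->
  (forall j, (0 < j <= N)%nat -> (w ^ j)%C <> 1) -> (n <= N)%nat -> (m <= N)%nat ->
  csum (fun k => (w ^ n * Cconj w ^ m) ^ k)%C N =
  if Nat.eqb n m then RtoC (INR (S N)) else RtoC 0.
Proof.
  intros Hw HN Hp Hn Hm; destruct (Nat.eqb_spec n m) as [<-|Hne].
  - rewrite unit_conj by exact Hw.
    rewrite (csum_ext _ (fun _ => RtoC 1)) by (intros; apply Cpow_1_l).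
    rewrite csum_RtoC, (@sum_n_const N 1); f_equal; ring.
  - apply csum_geom_root.
    + rewrite Cpow_mult_l, <- !Cpow_mult_r, !(Nat.mul_comm _ (S N)), !Cpow_mult_r.
      rewrite <- Cpow_conj, HN, Cconj_RtoC, !Cpow_1_l; ring.
    + intros E.
      assert (Q : (w ^ n = w ^ m)%C).
      { transitivity (w ^ n * Cconj w ^ m * w ^ m)%C; [|rewrite E; ring].
        rewrite <- Cmult_assoc, (Cmult_comm (Cconj w ^ m)), unit_conj by exact Hw; ring. }
      assert (K : forall i j, (i < j <= N)%nat -> (w ^ i = w ^ j)%C -> False).
      { intros i j Hij EQ; apply (Hp (j - i)%nat); [lia|].
        replace j with (i + (j - i))%nat in EQ by lia.
        rewrite Cpow_add_r in EQ.
        transitivity (w ^ i * w ^ (j - i) * Cconj w ^ i)%C.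
        - rewrite (Cmult_comm (w ^ i)), <- Cmult_assoc, unit_conj by exact Hw; ring.
        - rewrite <- EQ; apply unit_conj, Hw. }
      destruct (Nat.lt_total n m) as [L|[L|L]]; [|lia|].
      * apply (K n m); [lia | exact Q].
      * apply (K m n); [lia | now symmetry].
Qed.

(** Expand the square and sum over the roots of unity first; only the diagonal
    terms survive, because no two exponents up to [N] agree modulo [N + 1]. *)
Lemma discrete_parseval w N (q : nat -> C) :
  Cmod w = 1 -> (w ^ S N)%C = 1 ->
  (forall j, (0 < j <= N)%nat -> (w ^ j)%C <> 1) ->
  rsum (fun k => Cmod (csum (fun n => (w ^ k) ^ n * q n)%C N) ^ 2) N =
  INR (S N) * rsum (fun n => Cmod (q n) ^ 2) N.
Proof.
  intros Hw HN Hp; apply RtoC_inj.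
  rewrite RtoC_mult, <- !csum_RtoC, <- csum_scal.
  rewrite (csum_ext _ (fun k => csum (fun n => csum (fun m =>
    (q n * Cconj (q m)) * (w ^ n * Cconj w ^ m) ^ k)%C N) N)).
  2:{ intros k _; rewrite Cmod2_conj, csum_conj, csum_mult.
      apply csum_ext; intros n _; apply csum_ext; intros m _.
      rewrite Cmult_conj, !Cpow_conj, Cpow_mult_l, <- !Cpow_mult_r.
      rewrite (Nat.mul_comm n k), (Nat.mul_comm m k); ring. }
  rewrite csum_switch; apply csum_ext; intros n Hn.
  rewrite csum_switch.
  rewrite (csum_ext _ (fun m => if Nat.eqb n m
    then (q n * Cconj (q n) * RtoC (INR (S N)))%C else RtoC 0)).
  - rewrite csum_delta by exact Hn; rewrite Cmod2_conj; ring.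
  - intros m Hm; rewrite csum_scal, root_orthogonality; auto.
    destruct (Nat.eqb_spec n m) as [<-|_]; [reflexivity | ring].
Qed.

(** * Domination on a circle and Cauchy estimates *)

Lemma Cmod_unit_pow_mult z n a : Cmod z = 1 -> Cmod (z ^ n * a) = Cmod a.
Proof. intros H; rewrite Cmod_mult, Cmod_pow, H, pow1; ring. Qed.

(** Apply the discrete Parseval identity to the partial sums of order [N >=
    M].  They approximate the two functions on the circle up to the tails of
    the coefficient series, so the error in the comparison of the squares
    tends to 0 as [N] grows. *)
Lemma circle_domination (c h : nat -> C) M :
  ex_series (fun n => Cmod (c n)) -> ex_series (fun n => Cmod (h n)) ->
  (forall z F H, Cmod z = 1 -> cpseries c z F -> cpseries h z H -> Cmod F <= Cmod H) ->
  rsum (fun n => Cmod (c n) ^ 2) M <= Series (fun n => Cmod (h n) ^ 2).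
Proof.
  intros Ec Eh D.
  set (B := Series (fun n => Cmod (h n))).
  set (e := fun N => (Series (fun n => Cmod (c n)) - rsum (fun n => Cmod (c n)) N)
                     + (B - rsum (fun n => Cmod (h n)) N)).
  assert (e0 : is_lim_seq e 0).
  { apply is_lim_seq_plus0; apply Series_tail_lim0; assumption. }
  assert (B0 : 0 <= B) by (apply Series_ge0; auto using Cmod_ge_0).
  (* [B] bounds the partial sums [q] of [h], so replacing [|q| + e N] by [|q|] changes
     the square by at most the last summand *)
  assert (Q : forall N z, Cmod z = 1 ->
    Cmod (csum (fun n => z ^ n * c n)%C N) ^ 2 <=
    Cmod (csum (fun n => z ^ n * h n)%C N) ^ 2 + (2 * B * e N + e N * e N)).
  { intros N z Hz.
    assert (Bd : forall a n, Cmod (z ^ n * a n) <= Cmod (a n)).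
    { intros; rewrite Cmod_unit_pow_mult by exact Hz; lra. }
    destruct (cseries_abs _ _ (Bd c) Ec) as [F HF].
    destruct (cseries_abs _ _ (Bd h) Eh) as [H HH].
    assert (FH : Cmod F <= Cmod H) by (apply (D z); auto; now apply cpseries_cseries).
    pose proof (cseries_tail_le _ _ _ N (fun n => Cmod_ge_0 (c n))
                  (fun n _ => Bd c n) Ec HF) as TF.
    pose proof (cseries_tail_le _ _ _ N (fun n => Cmod_ge_0 (h n))
                  (fun n _ => Bd h n) Eh HH) as TH.
    assert (QB : Cmod (csum (fun n => z ^ n * h n)%C N) <= B).
    { eapply Rle_trans; [apply Cmod_csum_le|].
      eapply Rle_trans; [apply rsum_le; intros; apply Bd|].
      apply rsum_le_Series; auto using Cmod_ge_0. }
    set (p := csum (fun n => z ^ n * c n)%C N) in *.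
    set (q := csum (fun n => z ^ n * h n)%C N) in *.
    assert (PQ : Cmod p <= Cmod q + e N).
    { replace p with (F + (p - F))%C by ring.
      eapply Rle_trans; [apply Cmod_triangle|].
      assert (Cmod H <= Cmod q + Cmod (q - H)).
      { replace H with (q + - (q - H))%C at 1 by ring.
        eapply Rle_trans; [apply Cmod_triangle|]; rewrite Cmod_opp; lra. }
      unfold e; fold B in TH; lra. }
    pose proof (Cmod_ge_0 p); pose proof (Cmod_ge_0 q).
    assert (0 <= e N).
    { pose proof (Cmod_ge_0 (p - F)); pose proof (Cmod_ge_0 (q - H)).
      unfold e; fold B in TH; lra. }
    nra. }
  assert (el : is_lim_seq (fun N => 2 * B * e N + e N * e N) 0).
  { apply is_lim_seq_plus0.
    - replace (Finite 0) with (Finite (2 * B * 0)) by (f_equal; ring).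
      apply (is_lim_seq_scal_l e (2 * B) 0), e0.
    - replace (Finite 0) with (Finite (0 * 0)) by (f_equal; ring).
      apply is_lim_seq_mult'; exact e0. }
  apply (le_add_lim0 _ _ _ M el); intros N HN.
  destruct (primitive_root_ex N) as (w & Hw & HwN & Hwp).
  assert (SN : 0 < INR (S N)) by (apply lt_0_INR; lia).
  eapply Rle_trans; [apply (rsum_incr _ M N); auto using pow2_ge_0|].
  eapply Rle_trans; [|apply Rplus_le_compat_r, (rsum_le_Series _ N);
    auto using pow2_ge_0, ex_series_sq].
  apply (Rmult_le_reg_l _ _ _ SN); rewrite Rmult_plus_distr_l.
  rewrite <- !(discrete_parseval w) by assumption.
  rewrite <- (@sum_n_const N).
  rewrite <- (@sum_n_plus R_AbelianMonoid).
  apply rsum_le; intros k _; apply Q.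
  now rewrite Cmod_pow, Hw, pow1.
Qed.

(** Dilation to the unit circle. *)
Lemma scaled_circle_domination (c h : nat -> C) r M :
  0 <= r ->
  ex_series (fun n => Cmod (c n) * r ^ n) -> ex_series (fun n => Cmod (h n) * r ^ n) ->
  (forall z F H, Cmod z = r -> cpseries c z F -> cpseries h z H -> Cmod F <= Cmod H) ->
  rsum (fun n => (Cmod (c n) * r ^ n) ^ 2) M <= Series (fun n => (Cmod (h n) * r ^ n) ^ 2).
Proof.
  intros Hr Ec Eh D.
  pose (dil := fun (a : nat -> C) n => (RtoC r ^ n * a n)%C).
  assert (N : forall a n, Cmod (dil a n) = Cmod (a n) * r ^ n).
  { intros a n; unfold dil; rewrite Cmod_mult, Cmod_pow, Cmod_RtoC_pos by lra; ring. }
  assert (P : forall a z F, cpseries (dil a) z F -> cpseries a (r * z)%C F).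
  { intros a z F; rewrite !cpseries_cseries; apply cseries_ext; intros n.
    unfold dil; rewrite Cpow_mult_l; ring. }
  pose proof (circle_domination (dil c) (dil h) M) as Q.
  rewrite (Series_ext _ (fun n => (Cmod (h n) * r ^ n) ^ 2)) in Q
    by (intros; now rewrite N).
  eapply Rle_trans; [|apply Q].
  - apply rsum_le; intros n _; rewrite N; lra.
  - now apply (ex_series_ext (fun n => Cmod (c n) * r ^ n)); [intros; rewrite N|].
  - now apply (ex_series_ext (fun n => Cmod (h n) * r ^ n)); [intros; rewrite N|].
  - intros z F H Hz HF HH; apply (D (r * z)%C); auto.
    rewrite Cmod_mult, Hz, Cmod_RtoC_pos; lra.
Qed.

(** Domination by the constant [K]. *)
Lemma cauchy_estimate (c : nat -> C) r K m :
  0 <= r -> 0 <= K -> ex_series (fun n => Cmod (c n) * r ^ n) ->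
  (forall z F, Cmod z = r -> cpseries c z F -> Cmod F <= K) ->
  Cmod (c m) * r ^ m <= K.
Proof.
  intros Hr HK E B.
  pose proof (scaled_circle_domination c (const_coef (RtoC K)) r m Hr E) as Q.
  assert (X : forall n, Cmod (const_coef (RtoC K) n) * r ^ n
                        = Cmod (const_coef (RtoC K) n)).
  { intros [|n]; simpl; rewrite ?Cmod_0; ring. }
  destruct (const_coef_sums (RtoC K)) as (E1 & E2 & S2).
  rewrite Cmod_RtoC_pos in S2 by exact HK.
  assert (L : (Cmod (c m) * r ^ m) ^ 2 <= K ^ 2).
  { eapply Rle_trans;
      [apply (term_le_rsum (fun n => (Cmod (c n) * r ^ n) ^ 2) m m); auto using pow2_ge_0|].
    eapply Rle_trans; [apply Q|].
    - now apply (ex_series_ext _ _ (fun n => eq_sym (X n))).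
    - intros z F H Hz HF HH.
      rewrite (cseries_unique _ _ _ HH (cpseries_const (RtoC K) z)).
      rewrite Cmod_RtoC_pos by exact HK; now apply (B z).
    - rewrite (Series_ext _ (fun n => Cmod (const_coef (RtoC K) n) ^ 2)); auto.
      intros; now rewrite X. }
  apply Rsqr_incr_0_var; unfold Rsqr; simpl in *; lra.
Qed.

(** The difference of the two series satisfies a Cauchy estimate with bound 0. *)
Lemma cpseries_unique (a b : nat -> C) rho :
  0 < rho ->
  (forall z, Cmod z < rho -> exists l : C, cpseries a z l /\ cpseries b z l) ->
  forall n, a n = b n.
Proof.
  intros Hrho H n.
  (* convergence at radius [2 rho / 3] gives absolute convergence at [rho / 2] *)
  assert (T : Cmod (RtoC (2 * rho / 3)) = 2 * rho / 3) by (apply Cmod_RtoC_pos; lra).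
  destruct (H (RtoC (2 * rho / 3))) as (l & Ha & Hb); [rewrite T; lra|].
  pose proof (cpseries_minus _ _ _ _ _ Ha Hb) as Hc.
  apply cpseries_abs_conv with (r := rho / 2) in Hc; [|rewrite T; lra].
  assert (Z : Cmod (a n - b n) * (rho / 2) ^ n <= 0).
  { apply (cauchy_estimate (fun n => a n - b n)%C); auto; try lra.
    intros z F Hz HF.
    destruct (H z) as (k & Ka & Kb); [lra|].
    rewrite (cseries_unique _ _ _ HF (cpseries_minus _ _ _ _ _ Ka Kb)).
    replace (k - k)%C with (RtoC 0) by ring; rewrite Cmod_0; lra. }
  assert (P : 0 < (rho / 2) ^ n) by (apply pow_lt; lra).
  assert (Z' : (a n - b n)%C = RtoC 0) by (apply Cmod_le_0; nra).
  replace (a n) with ((a n - b n) + b n)%C by ring; rewrite Z'; ring.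
Qed.

(** * Recentring a power series *)

(** Extended by 0 above the diagonal, where the factorial formula of
    [Binomial.C] with its truncated subtraction does not vanish; Pascal's rule
    then has no side condition. *)
Definition binom (m n : nat) : R := if Nat.leb n m then Binomial.C m n else 0.

Lemma binom_0 m : binom m 0 = 1.
Proof.
  unfold binom, Binomial.C; simpl Nat.leb; cbv iota.
  rewrite Nat.sub_0_r; simpl (Factorial.fact 0); simpl (INR 1).
  field; apply INR_fact_neq_0.
Qed.

Lemma binom_S m n : binom (S m) (S n) = binom m n + binom m (S n).
Proof.
  unfold binom; simpl (Nat.leb (S n) (S m)).
  destruct (Nat.leb_spec n m) as [L|L], (Nat.leb_spec (S n) m) as [L'|L']; try lia.
  - now rewrite pascal by lia.
  - replace n with m by lia; unfold Binomial.C; rewrite !Nat.sub_diag; simpl (Factorial.fact 0).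
    simpl (INR 1); field; split; apply INR_fact_neq_0.
  - ring.
Qed.

Lemma binom_ge0 m n : 0 <= binom m n.
Proof.
  unfold binom; destruct (Nat.leb n m); [|lra].
  unfold Binomial.C; apply Rmult_le_pos; [apply pos_INR|].
  apply Rlt_le, Rinv_0_lt_compat, Rmult_lt_0_compat; apply INR_fact_lt_0.
Qed.

Lemma binom_gt m n : (m < n)%nat -> binom m n = 0.
Proof. intros H; unfold binom; now rewrite (proj2 (Nat.leb_gt n m) H). Qed.

Lemma binomial_sum (u y : C) m :
  csum (fun n => RtoC (binom m n) * u ^ (m - n) * y ^ n)%C m = ((u + y) ^ m)%C.
Proof.
  induction m as [|m IH].
  - rewrite csum_0, binom_0; simpl; Cring.
  - rewrite csum_S_l, Cpow_S, <- IH, Cmult_plus_distr_r.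
    replace (csum (fun k => RtoC (binom (S m) (S k)) * u ^ (S m - S k) * y ^ S k)%C m)
      with (y * csum (fun n => RtoC (binom m n) * u ^ (m - n) * y ^ n)%C m
        + csum (fun n => u * (RtoC (binom m (S n)) * u ^ (m - S n) * y ^ S n))%C m)%C.
    + replace (u * csum (fun n => RtoC (binom m n) * u ^ (m - n) * y ^ n)%C m)%C
        with (csum (fun n => u * (RtoC (binom m n) * u ^ (m - n) * y ^ n))%C (S m))%C.
      * rewrite csum_S_l, !binom_0, !Nat.sub_0_r.
        rewrite Cpow_S; Cring.
      * rewrite csum_S, csum_scal, (binom_gt m (S m)) by lia; Cring.
    + rewrite <- csum_scal, <- csum_plus; apply csum_ext; intros n Hn.
      rewrite binom_S, RtoC_plus, Nat.sub_succ, Cpow_S.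
      destruct (Nat.eq_dec n m) as [->|Hne].
      * rewrite (binom_gt m (S m)) by lia; ring.
      * replace (m - n)%nat with (S (m - S n)) by lia; rewrite Cpow_S; ring.
Qed.

Lemma binomial_rsum d v m :
  rsum (fun n => binom m n * d ^ (m - n) * v ^ n) m = (d + v) ^ m.
Proof.
  apply RtoC_inj; rewrite <- csum_RtoC, RtoC_pow, RtoC_plus, <- binomial_sum.
  apply csum_ext; intros n _; now rewrite !RtoC_mult, !RtoC_pow.
Qed.

(** Expand every [(u + y)^m] by the binomial theorem and sum by columns.  The
    new coefficient [b n] is the sum over [m] of [binom m n * a m * u^(m -
    n)]; the first clause states this after multiplication by [u^n], which
    makes it a power series in [u] whose coefficients are those of [a] up to
    binomial factors, so that Cauchy estimates in [u] bound [a]. *)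
Lemma recenter (a : nat -> C) (u : C) K t :
  (forall m, Cmod (a m) * t ^ m <= K) -> Cmod u < t ->
  exists b : nat -> C,
    (forall n, cpseries (fun m => RtoC (binom m n) * a m)%C u (u ^ n * b n)%C) /\
    (forall n v, 0 <= v -> Cmod u + v < t ->
       Cmod (b n) * v ^ n <= K / (1 - (Cmod u + v) / t)) /\
    (forall y l, Cmod u + Cmod y < t -> cpseries a (u + y)%C l -> cpseries b y l).
Proof.
  intros Ba Hu; pose proof (Cmod_ge_0 u) as u0.
  assert (K0 : 0 <= K).
  { eapply Rle_trans; [|apply (Ba 0%nat)].
    apply Rmult_le_pos; [apply Cmod_ge_0 | apply pow_le; lra]. }
  pose (T := fun m n => (RtoC (binom m n) * u ^ (m - n) * a m)%C).
  assert (T0 : forall m n, (m < n)%nat -> T m n = RtoC 0).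
  { intros m n H; unfold T; rewrite binom_gt by exact H; ring. }
  (* the dominating geometric series of the rows of the array T m n * y^n *)
  pose (rho := fun v m => K * ((Cmod u + v) / t) ^ m).
  assert (Erho : forall v, 0 <= v -> Cmod u + v < t ->
    ex_series (rho v) /\ Series (rho v) = K / (1 - (Cmod u + v) / t)).
  { intros v Hv L; apply ex_series_scaled_geom, ratio_lt_1; lra. }
  assert (Row : forall v m, 0 <= v -> Cmod u + v < t ->
    rsum (fun n => Cmod (T m n) * v ^ n) m <= rho v m).
  { intros v m Hv L; unfold rho.
    eapply Rle_trans; [|apply (geom_domination a K t (Cmod u + v) Ba); lra].
    rewrite <- binomial_rsum, <- rsum_scal; apply rsum_le; intros n _; unfold T.
    rewrite !Cmod_mult, Cmod_pow, Cmod_RtoC_pos by apply binom_ge0; lra. }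
  assert (Term : forall v m n, 0 <= v -> Cmod u + v < t -> Cmod (T m n) * v ^ n <= rho v m).
  { intros v m n Hv L; eapply Rle_trans; [|apply (Row v m Hv L)].
    assert (P : forall k, 0 <= Cmod (T m k) * v ^ k)
      by (intros; apply Rmult_le_pos; [apply Cmod_ge_0 | now apply pow_le]).
    destruct (Nat.le_gt_cases n m) as [N|N].
    - apply (term_le_rsum (fun n => Cmod (T m n) * v ^ n)); auto.
    - rewrite (T0 m n N), Cmod_0, Rmult_0_l; now apply rsum_ge0. }
  set (v0 := (t - Cmod u) / 2).
  assert (Ec : forall n, exists l : C, cseries (fun m => T m n) l).
  { intros n.
    apply (cseries_abs _ (fun m => / v0 ^ n * rho v0 m)).
    - intros m; assert (P : 0 < v0 ^ n) by (apply pow_lt; unfold v0; lra).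
      apply (Rmult_le_reg_r (v0 ^ n)); [exact P|].
      replace (/ v0 ^ n * rho v0 m * v0 ^ n) with (rho v0 m) by (field; lra).
      apply Term; unfold v0; lra.
    - apply (@ex_series_scal R_AbsRing R_NormedModule), Erho; unfold v0; lra. }
  pose (b := fun n => proj1_sig (constructive_indefinite_description _ (Ec n))).
  assert (Hb : forall n, cseries (fun m => T m n) (b n))
    by (intros n; apply (proj2_sig (constructive_indefinite_description _ (Ec n)))).
  exists b; split; [|split].
  - intros n; apply cpseries_cseries.
    apply (cseries_ext (fun m => u ^ n * T m n)%C); [|apply cseries_scal, Hb].
    intros m; unfold T.
    destruct (Nat.le_gt_cases n m) as [N|N].
    + replace (u ^ m)%C with (u ^ n * u ^ (m - n))%C
        by (rewrite <- Cpow_add_r; f_equal; lia); ring.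
    + rewrite binom_gt by exact N; ring.
  - intros n v Hv L; destruct (Erho v Hv L) as [E S]; rewrite <- S.
    replace (Cmod (b n) * v ^ n) with (Cmod (RtoC (v ^ n) * b n))
      by (rewrite Cmod_mult, Cmod_RtoC_pos by (now apply pow_le); ring).
    apply (cseries_norm_le (fun m => RtoC (v ^ n) * T m n)%C); auto.
    + intros m; rewrite Cmod_mult, Cmod_RtoC_pos by (now apply pow_le).
      rewrite Rmult_comm; now apply Term.
    + apply cseries_scal, Hb.
  - intros y l L Hl; apply cpseries_cseries in Hl; apply cpseries_cseries.
    apply (triangular_fubini (fun m n => y ^ n * T m n)%C (rho (Cmod y)));
      try apply Erho; auto using Cmod_ge_0.
    + intros m n H; rewrite T0 by exact H; ring.
    + intros m; eapply Rle_trans; [|apply (Row (Cmod y) m); auto using Cmod_ge_0].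
      apply rsum_le; intros n _; right.
      rewrite Cmod_mult, Cmod_pow; ring.
    + intros n; apply cseries_scal, Hb.
    + revert Hl; apply cseries_ext; intros m.
      rewrite <- binomial_sum, Cmult_comm, <- csum_scal.
      apply csum_ext; intros n _; unfold T; ring.
Qed.

(** * Analytic functions have one expansion on the whole disc *)

(** The same number [d] serves as a radius and, through [/ d], as a bound on
    the coefficients, so that one compactness argument makes both uniform. *)
Definition good_radius (f : C -> C) (d : R) (z0 : C) : Prop :=
  exists b : nat -> C,
    (forall z, Cmod (z - z0) < d -> cpseries b (z - z0)%C (f z)) /\
    (forall n, Cmod (b n) * d ^ n <= / d).

Definition expands_at_0 (f : C -> C) (r : R) (a : nat -> C) : Prop :=
  forall z, Cmod z < r -> cpseries a z (f z).

Lemma good_radius_le f d d' z0 :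
  0 < d' <= d -> good_radius f d z0 -> good_radius f d' z0.
Proof.
  intros Hd (b & Hb & Bb); exists b; split.
  - intros z Hz; apply Hb; lra.
  - intros n; eapply Rle_trans; [|eapply Rle_trans; [apply (Bb n)|]].
    + apply Rmult_le_compat_l; [apply Cmod_ge_0 | apply pow_incr; lra].
    + apply Rinv_le_contravar; lra.
Qed.

(** The expansion at [z1] recentred at a nearby point: the bound on its
    coefficients is inherited up to a factor 2, and a small [d] absorbs it in
    [/ d]. *)
Lemma good_radius_local f z1 :
  analytic_on_disc f -> in_disc z1 ->
  exists d, 0 < d /\ forall z0, Cmod (z0 - z1) < 2 * d -> good_radius f d z0.
Proof.
  intros Hf Hz1; unfold in_disc in Hz1.
  destruct (Hf z1 Hz1) as (r & a & Ha).
  pose proof (cond_pos r) as Hr.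
  (* the factor 1/2 keeps the point [z1 + t], where the coefficients are bounded,
     inside the disc where the expansion is valid *)
  set (t := Rmin r (1 - Cmod z1) / 2).
  assert (Ht : 0 < t /\ 2 * t <= r /\ 2 * t <= 1 - Cmod z1).
  { unfold t; pose proof (Rmin_l r (1 - Cmod z1)); pose proof (Rmin_r r (1 - Cmod z1)).
    assert (0 < Rmin r (1 - Cmod z1)) by (apply Rmin_pos; lra); lra. }
  destruct Ht as (t0 & tr & tz).
  assert (Ex : forall z, Cmod (z - z1) < 2 * t -> cpseries a (z - z1)%C (f z)).
  { intros z Hz; apply Ha; [|lra]; unfold in_disc.
    replace z with (z1 + (z - z1))%C by ring.
    eapply Rle_lt_trans; [apply Cmod_triangle | lra]. }
  assert (Et : (z1 + RtoC t - z1)%C = RtoC t) by ring.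
  assert (Ct : Cmod (RtoC t) = t) by (apply Cmod_RtoC_pos; lra).
  destruct (cpseries_bounded a (RtoC t) (f (z1 + RtoC t)%C)) as [K HK].
  { rewrite <- Et at 1; apply Ex; rewrite Et, Ct; lra. }
  rewrite Ct in HK.
  assert (K0 : 0 <= K).
  { eapply Rle_trans; [|apply (HK 0%nat)]; simpl; pose proof (Cmod_ge_0 (a 0%nat)); lra. }
  (* [3 d <= t / 2] halves the geometric ratio in [recenter], and the second
     bound makes [2 K <= / d] *)
  set (d := Rmin (t / 6) (/ (2 * K + 1))).
  assert (Hd : 0 < d) by (apply Rmin_pos; [lra | apply Rinv_0_lt_compat; lra]).
  assert (dt : d <= t / 6) by apply Rmin_l.
  assert (dK : 2 * K <= / d).
  { assert (D : d <= / (2 * K + 1)) by apply Rmin_r.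
    apply Rinv_le_contravar in D; [|exact Hd].
    rewrite Rinv_inv in D; lra. }
  exists d; split; [exact Hd|]; intros z0 Hz0.
  destruct (recenter a (z0 - z1)%C K t HK) as (b & _ & Bb & Cb); [lra|].
  exists b; split.
  - intros z Hz; apply Cb; [lra|].
    replace (z0 - z1 + (z - z0))%C with (z - z1)%C by ring.
    apply Ex; replace (z - z1)%C with ((z0 - z1) + (z - z0))%C by ring.
    eapply Rle_lt_trans; [apply Cmod_triangle | lra].
  - intros n; eapply Rle_trans; [apply (Bb n d); lra|].
    eapply Rle_trans; [|exact dK].
    assert (Q : (Cmod (z0 - z1) + d) / t <= / 2).
    { apply (Rmult_le_reg_r t); [exact t0|].
      replace ((Cmod (z0 - z1) + d) / t * t) with (Cmod (z0 - z1) + d) by (field; lra).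
      lra. }
    replace (2 * K) with (K * / / 2) by (field).
    unfold Rdiv at 1; apply Rmult_le_compat_l; [exact K0|].
    apply Rinv_le_contravar; lra.
Qed.

(** A Lebesgue number for the cover by the discs of [good_radius_local].  The
    compactness principle is about a square, so the points outside the open
    unit disc get a neighbourhood that misses the disc of radius [r]. *)
Lemma good_radius_uniform f r :
  analytic_on_disc f -> 0 <= r < 1 ->
  exists d, 0 < d /\ forall z, Cmod z <= r -> good_radius f d z.
Proof.
  intros Hf Hr.
  assert (Loc : forall z1 : C, exists d : posreal, forall z0,
    Cmod z0 <= r -> Cmod (z0 - z1) < 2 * d -> good_radius f d z0).
  { intros z1; destruct (Rlt_le_dec (Cmod z1) 1) as [H|H].
    - destruct (good_radius_local f z1 Hf H) as (d & d0 & Hd).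
      exists (mkposreal d d0); intros z0 _; apply Hd.
    - assert (P : 0 < (1 - r) / 2) by lra.
      exists (mkposreal _ P); simpl; intros z0 Hz0 H1; exfalso.
      assert (Cmod z1 <= Cmod z0 + Cmod (z0 - z1)).
      { replace z1 with (z0 + - (z0 - z1))%C at 1 by ring.
        eapply Rle_trans; [apply Cmod_triangle|]; rewrite Cmod_opp; lra. }
      lra. }
  pose (D := fun z1 => proj1_sig (constructive_indefinite_description _ (Loc z1))).
  assert (HD : forall z1 z0, Cmod z0 <= r -> Cmod (z0 - z1) < 2 * D z1 ->
    good_radius f (D z1) z0)
    by (intros z1; apply (proj2_sig (constructive_indefinite_description _ (Loc z1)))).
  destruct (compactness_value_2d (-1) 1 (-1) 1 (fun x y => D (x, y))) as [d Hd].
  exists d; split; [apply cond_pos|]; intros z Hz; apply NNPP; intros NG.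
  assert (Z : -1 <= fst z <= 1 /\ -1 <= snd z <= 1).
  { pose proof (Rmax_Cmod z); pose proof (Rmax_l (Rabs (fst z)) (Rabs (snd z)));
    pose proof (Rmax_r (Rabs (fst z)) (Rabs (snd z))).
    split; apply Rabs_le_between; lra. }
  apply (Hd (fst z) (snd z) (proj1 Z) (proj2 Z)).
  intros (u & v & _ & _ & Hu & Hv & L); apply NG.
  apply (good_radius_le f (D (u, v))); [split; [apply cond_pos | exact L]|].
  apply HD; [exact Hz|].
  eapply Rle_lt_trans; [apply Cmod_le_re_im|].
  change (fst (z - (u, v))%C) with (fst z - u); change (snd (z - (u, v))%C) with (snd z - v).
  lra.
Qed.

(** Near [z0] both series represent [f]. *)
Lemma recentered_coef_eq f r a t d (z0 : C) (b b' : nat -> C) :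
  expands_at_0 f r a -> Cmod z0 < r -> Cmod z0 < t -> 0 < d ->
  (forall z, Cmod (z - z0) < d -> cpseries b (z - z0)%C (f z)) ->
  (forall y l, Cmod z0 + Cmod y < t -> cpseries a (z0 + y)%C l -> cpseries b' y l) ->
  forall n, b' n = b n.
Proof.
  intros Ha Hr Ht Hd Hb Hb'.
  set (rho := Rmin d (Rmin (r - Cmod z0) (t - Cmod z0))).
  assert (L : 0 < rho /\ rho <= d /\ rho <= r - Cmod z0 /\ rho <= t - Cmod z0).
  { unfold rho; split; [apply Rmin_pos; [|apply Rmin_pos]; lra|].
    split; [apply Rmin_l|]; split.
    - eapply Rle_trans; [apply Rmin_r | apply Rmin_l].
    - eapply Rle_trans; [apply Rmin_r | apply Rmin_r]. }
  apply (cpseries_unique b' b rho (proj1 L)); intros y Hy.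
  assert (E : (z0 + y - z0)%C = y) by ring.
  exists (f (z0 + y)%C); split.
  - apply Hb'; [lra|]; apply Ha.
    eapply Rle_lt_trans; [apply Cmod_triangle | lra].
  - rewrite <- E at 1; apply Hb; rewrite E; lra.
Qed.

Lemma rsum_geom_half_le n : rsum (fun k => (/ 2) ^ k) n <= 2.
Proof.
  assert (E : is_series (fun k => (/ 2) ^ k) (/ (1 - / 2)))
    by (apply is_series_geom; rewrite Rabs_pos_eq; lra).
  eapply Rle_trans; [apply rsum_le_Series|].
  - intros k; apply pow_le; lra.
  - eexists; exact E.
  - rewrite (is_series_unique _ _ E); lra.
Qed.

(** For [|z| = r'] the coefficient of order [n] at [z] is bounded by [d^(- n -
    1)], uniformly in [z].  The Cauchy estimate in [z] turns this into [binom
    m n * |a m| * r'^(m - n) <= d^(- n - 1)].  Multiplying by [(d / 2)^n] and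
    summing over [n], the left side becomes [|a m| (r' + d / 2)^m] by the
    binomial theorem, and the right side a geometric sum. *)
Lemma expansion_coef_growth f d r a r' :
  0 < d -> 0 < r' < r -> expands_at_0 f r a ->
  (forall z, Cmod z = r' -> good_radius f d z) ->
  forall m, Cmod (a m) * (r' + d / 2) ^ m <= 2 / d.
Proof.
  intros Hd Hr Ha HQ m.
  (* [r' < s < t < r]: the coefficients are bounded at [t], and the series in [u]
     of [recenter] converges at [s], hence absolutely at [r'] *)
  set (t := (r' + r) / 2); set (s := (r' + t) / 2).
  assert (Ct : Cmod (RtoC t) = t) by (apply Cmod_RtoC_pos; unfold t; lra).
  assert (Cs : Cmod (RtoC s) = s) by (apply Cmod_RtoC_pos; unfold s, t; lra).
  assert (Ord : r' < s < t /\ t < r) by (unfold s, t; lra).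
  destruct (cpseries_bounded a (RtoC t) (f (RtoC t))) as [K HK].
  { apply Ha; lra. }
  rewrite Ct in HK.
  assert (Est : forall n, Cmod (RtoC (binom m n) * a m) * r' ^ m <= r' ^ n * (/ d * / d ^ n)).
  { intros n.
    assert (dn : 0 < d ^ n) by (apply pow_lt; lra).
    assert (di : 0 < / d) by (apply Rinv_0_lt_compat; lra).
    apply (cauchy_estimate (fun m => RtoC (binom m n) * a m)%C); [lra | | |].
    - apply Rmult_le_pos; [apply pow_le; lra|].
      apply Rmult_le_pos; [lra | apply Rlt_le, Rinv_0_lt_compat; lra].
    - destruct (recenter a (RtoC s) K t HK) as (b & Hb & _); [lra|].
      apply (cpseries_abs_conv _ _ _ _ (Hb n)); lra.
    - intros z F Hz HF.
      destruct (recenter a z K t HK) as (b' & Hb' & _ & Cb'); [lra|].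
      destruct (HQ z Hz) as (b & Eb & Bb).
      rewrite (cseries_unique _ _ _ HF (Hb' n)), Cmod_mult, Cmod_pow, Hz.
      apply Rmult_le_compat_l; [apply pow_le; lra|].
      rewrite (recentered_coef_eq f r a t d z b b'); auto; try lra.
      apply (Rmult_le_reg_r (d ^ n)); [exact dn|].
      replace (/ d * / d ^ n * d ^ n) with (/ d) by (field; lra); apply Bb. }
  rewrite <- binomial_rsum, <- rsum_scal.
  apply Rle_trans with (/ d * rsum (fun k => (/ 2) ^ k) m).
  - rewrite <- rsum_scal; apply rsum_le; intros n Hn.
    specialize (Est n).
    rewrite Cmod_mult, Cmod_RtoC_pos in Est by apply binom_ge0.
    assert (rn : 0 < r' ^ n) by (apply pow_lt; lra).
    assert (dn : 0 < d ^ n) by (apply pow_lt; lra).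
    replace (r' ^ m) with (r' ^ n * r' ^ (m - n)) in Est
      by (rewrite <- pow_add; f_equal; lia).
    assert (Est' : binom m n * Cmod (a m) * r' ^ (m - n) <= / d * / d ^ n)
      by (apply (Rmult_le_reg_l (r' ^ n)); [exact rn | lra]).
    replace ((d / 2) ^ n) with (d ^ n * (/ 2) ^ n)
      by (rewrite <- Rpow_mult_distr; f_equal).
    assert (h : 0 < (/ 2) ^ n) by (apply pow_lt; lra).
    replace (Cmod (a m) * (binom m n * r' ^ (m - n) * (d ^ n * (/ 2) ^ n)))
      with ((binom m n * Cmod (a m) * r' ^ (m - n)) * (d ^ n * (/ 2) ^ n)) by ring.
    replace (/ d * (/ 2) ^ n) with ((/ d * / d ^ n) * (d ^ n * (/ 2) ^ n)) by (field; lra).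
    apply Rmult_le_compat_r; [nra | exact Est'].
  - replace (2 / d) with (/ d * 2) by (field; lra).
    apply Rmult_le_compat_l; [apply Rlt_le, Rinv_0_lt_compat; lra|].
    apply rsum_geom_half_le.
Qed.

(** The coefficient bounds make the series converge beyond [r].  To see that
    it still represents [f] at [z], recentre it at the point of the circle of
    radius [r' < r] on the ray of [z]: the result is the local expansion of
    [f] there, whose disc contains [z]. *)
Lemma expands_at_0_grow f d r R0 a :
  0 < d <= r -> r <= R0 -> (forall z, Cmod z <= R0 -> good_radius f d z) ->
  expands_at_0 f r a -> expands_at_0 f (r + d / 4) a.
Proof.
  intros Hd HR HQ Ha z Hz.
  destruct (Rlt_le_dec (Cmod z) r) as [L|L]; [now apply Ha|].
  set (r' := r - d / 8).
  assert (G : forall m, Cmod (a m) * (r' + d / 2) ^ m <= 2 / d).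
  { apply (expansion_coef_growth f d r a); auto; unfold r'; try lra.
    intros y Hy; apply HQ; lra. }
  (* the point of the ray through z on the circle of radius r' *)
  set (z0 := (RtoC (r' / Cmod z) * z)%C).
  assert (q0 : 0 <= r' / Cmod z < 1) by (apply ratio_lt_1; unfold r'; lra).
  assert (C0 : Cmod z0 = r').
  { unfold z0; rewrite Cmod_mult, Cmod_RtoC_pos by lra; field; lra. }
  assert (C1 : Cmod (z - z0) = Cmod z - r').
  { replace (z - z0)%C with (RtoC (1 - r' / Cmod z) * z)%C
      by (unfold z0; rewrite RtoC_minus; ring).
    rewrite Cmod_mult, Cmod_RtoC_pos by lra; field; lra. }
  destruct (recenter a z0 (2 / d) (r' + d / 2) G) as (b' & _ & _ & Cb'); [lra|].
  destruct (HQ z0) as (b & Eb & _); [unfold r' in C0; lra|].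
  assert (E : forall n, b' n = b n).
  { apply (recentered_coef_eq f r a (r' + d / 2) d z0); auto; rewrite ?C0; unfold r'; lra. }
  destruct (cpseries_ex a z) as [g Hg].
  { apply (abs_conv_of_bounded a (2 / d) (r' + d / 2)); auto.
    split; [apply Cmod_ge_0 | unfold r'; lra]. }
  replace (f z) with g; [exact Hg|].
  assert (Hg' : cpseries b' (z - z0)%C g).
  { apply Cb'; [unfold r' in *; lra|].
    now replace (z0 + (z - z0))%C with z by ring. }
  apply (cseries_unique _ _ _ (proj1 (cpseries_cseries _ _ _) Hg')).
  apply (cseries_ext (fun n => (z - z0) ^ n * b n)%C); [intros n; now rewrite E|].
  apply cpseries_cseries, Eb; unfold r' in *; lra.
Qed.

Lemma expands_at_0_le f r r' a : r' <= r -> expands_at_0 f r a -> expands_at_0 f r' a.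
Proof. intros H Ha z Hz; apply Ha; lra. Qed.

(** Each step of [expands_at_0_grow] gains the fixed amount [d / 4], so
    finitely many reach [r]. *)
Lemma expands_at_0_ex f r :
  analytic_on_disc f -> 0 <= r < 1 -> exists a, expands_at_0 f r a.
Proof.
  intros Hf Hr; destruct (good_radius_uniform f r Hf Hr) as (d & d0 & HQ).
  assert (Step : forall n : nat, (exists a, expands_at_0 f r a) \/
    (d + INR n * (d / 4) <= r /\ exists a, expands_at_0 f (d + INR n * (d / 4)) a)).
  { induction n as [|n [IH|(Hn & a & Ha)]]; [|now left|].
    - destruct (HQ 0) as (b & Hb & _); [rewrite Cmod_0; lra|].
      assert (E : expands_at_0 f d b).
      { intros z Hz; replace z with (z - 0)%C at 1 by ring.
        apply Hb; now replace (z - 0)%C with z by ring. }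
      simpl; rewrite Rmult_0_l, Rplus_0_r.
      destruct (Rle_lt_dec d r); [right; split; [lra|]; now exists b | left].
      exists b; apply (expands_at_0_le f d); auto; lra.
    - assert (G : expands_at_0 f (d + INR (S n) * (d / 4)) a).
      { rewrite S_INR.
        replace (d + (INR n + 1) * (d / 4)) with (d + INR n * (d / 4) + d / 4) by ring.
        apply (expands_at_0_grow f d _ r); auto.
        pose proof (pos_INR n); split; [lra | nra]. }
      destruct (Rle_lt_dec (d + INR (S n) * (d / 4)) r);
        [right; split; [lra|]; now exists a | left].
      exists a; eapply expands_at_0_le; [|exact G]; lra. }
  destruct (nfloor_ex (r / (d / 4))) as [n Hn].
  { apply Rmult_le_pos; [lra | apply Rlt_le, Rinv_0_lt_compat; lra]. }
  destruct (Step (S n)) as [H|[H _]]; [exact H | exfalso].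
  rewrite S_INR in H.
  assert (r / (d / 4) * (d / 4) < (INR n + 1) * (d / 4)) by (apply Rmult_lt_compat_r; lra).
  replace (r / (d / 4) * (d / 4)) with r in H0 by (field; lra); lra.
Qed.

(** The expansions on the discs of radius less than 1 agree, by uniqueness. *)
Lemma taylor_of_analytic f : analytic_on_disc f -> exists a, is_taylor f a.
Proof.
  intros Hf.
  destruct (expands_at_0_ex f (/ 2) Hf) as [a Ha]; [lra|].
  exists a; intros z Hz; unfold in_disc in Hz.
  set (r := (Cmod z + 1) / 2).
  assert (Hr : / 2 <= r < 1 /\ Cmod z < r)
    by (pose proof (Cmod_ge_0 z); unfold r; lra).
  destruct (expands_at_0_ex f r Hf) as [a' Ha']; [lra|].
  assert (E : forall n, a' n = a n).
  { apply (cpseries_unique a' a (/ 2)); [lra|].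
    intros y Hy; exists (f y); split; [apply Ha' | apply Ha]; lra. }
  apply cpseries_cseries, (cseries_ext (fun n => z ^ n * a' n)%C).
  - intros n; now rewrite E.
  - apply cpseries_cseries, Ha'; lra.
Qed.

(** * Operations on expansions on the disc *)

Lemma taylor_abs_conv f (a : nat -> C) r :
  is_taylor f a -> 0 <= r < 1 -> ex_series (fun n => Cmod (a n) * r ^ n).
Proof.
  intros H Hr.
  assert (T : Cmod (RtoC ((r + 1) / 2)) = (r + 1) / 2) by (apply Cmod_RtoC_pos; lra).
  apply (cpseries_abs_conv a (RtoC ((r + 1) / 2)) (f (RtoC ((r + 1) / 2)))).
  - apply H; unfold in_disc; rewrite T; lra.
  - rewrite T; lra.
Qed.

Lemma taylor_unique f (a b : nat -> C) :
  is_taylor f a -> is_taylor f b -> forall n, a n = b n.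
Proof.
  intros Ha Hb; apply (cpseries_unique a b 1 Rlt_0_1).
  intros z Hz; exists (f z); split; auto.
Qed.

Lemma is_taylor_ext F G a : eq_on_disc F G -> is_taylor F a -> is_taylor G a.
Proof. intros E H z Hz; rewrite <- E by exact Hz; now apply H. Qed.

Lemma taylor_const (c : C) : is_taylor (fun _ => c) (const_coef c).
Proof. intros z _; apply cpseries_const. Qed.

Lemma taylor_id : exists a, is_taylor (fun z => z) a.
Proof.
  exists (fun n => match n with 1%nat => RtoC 1 | _ => RtoC 0 end).
  intros z _; apply cpseries_cseries.
  assert (H := cseries_finite (fun n => z ^ n *
    match n with 1%nat => RtoC 1 | _ => RtoC 0 end)%C 1).
  rewrite csum_S, csum_0 in H; simpl in H.
  replace (1 * 0 + z * 1 * 1)%C with z in H by ring.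
  apply H; intros [|[|n]] Hn; [lia | lia | simpl; ring].
Qed.

Lemma taylor_plus F G (a b : nat -> C) :
  is_taylor F a -> is_taylor G b ->
  is_taylor (fun z => F z + G z)%C (fun n => a n + b n)%C.
Proof.
  intros Ha Hb z Hz; apply cpseries_cseries.
  apply (cseries_ext (fun n => z ^ n * a n + z ^ n * b n)%C); [intros; ring|].
  apply cseries_plus; apply cpseries_cseries; [apply Ha | apply Hb]; exact Hz.
Qed.

Lemma taylor_scal F (c : C) (a : nat -> C) :
  is_taylor F a -> is_taylor (fun z => c * F z)%C (fun n => c * a n)%C.
Proof.
  intros Ha z Hz; apply cpseries_cseries.
  apply (cseries_ext (fun n => c * (z ^ n * a n))%C); [intros; ring|].
  apply cseries_scal, cpseries_cseries, Ha, Hz.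
Qed.

Lemma taylor_minus F G (a b : nat -> C) :
  is_taylor F a -> is_taylor G b ->
  is_taylor (fun z => F z - G z)%C (fun n => a n - b n)%C.
Proof. intros Ha Hb z Hz; apply cpseries_minus; [apply Ha | apply Hb]; exact Hz. Qed.

Lemma taylor_mult F G (a b : nat -> C) :
  is_taylor F a -> is_taylor G b ->
  is_taylor (fun z => F z * G z)%C (fun k => csum (fun n => a n * b (k - n)%nat)%C k).
Proof.
  intros HF HG z Hz.
  pose (u := fun k n => if Nat.leb n k then (z ^ k * (a n * b (k - n)%nat))%C else RtoC 0).
  pose (A := fun n => Cmod (a n) * Cmod z ^ n).
  pose (B := fun n => Cmod (b n) * Cmod z ^ n).
  assert (z01 : 0 <= Cmod z < 1) by (split; [apply Cmod_ge_0 | exact Hz]).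
  assert (EA : ex_series A) by (now apply (taylor_abs_conv F)).
  assert (EB : ex_series B) by (now apply (taylor_abs_conv G)).
  assert (A0 : forall n, 0 <= A n)
    by (intros; apply Rmult_le_pos; [apply Cmod_ge_0 | apply pow_le, Cmod_ge_0]).
  assert (B0 : forall n, 0 <= B n)
    by (intros; apply Rmult_le_pos; [apply Cmod_ge_0 | apply pow_le, Cmod_ge_0]).
  apply cpseries_cseries.
  apply (cseries_ext (fun k => csum (u k) k)).
  { intros k; rewrite <- csum_scal; apply csum_ext; intros n Hn.
    unfold u; now rewrite (proj2 (Nat.leb_le n k) Hn). }
  apply (triangular_fubini u (fun k => sum_f_R0 (fun n => A n * B (k - n)%nat) k)
           (fun n => z ^ n * a n * G z)%C).
  - intros k n Hn; unfold u; now rewrite (proj2 (Nat.leb_gt n k) Hn).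
  - intros k; rewrite <- sum_n_Reals; apply rsum_le; intros n Hn.
    unfold u, A, B; rewrite (proj2 (Nat.leb_le n k) Hn).
    replace (Cmod z ^ n) with (Cmod (z ^ n)) by apply Cmod_pow.
    rewrite <- Cmod_pow, <- !Cmod_mult; right; f_equal.
    replace (z ^ k)%C with (z ^ n * z ^ (k - n))%C
      by (rewrite <- Cpow_add_r; f_equal; lia); ring.
  - eexists; apply is_series_mult_pos; auto; apply Series_correct; eassumption.
  - intros n.
    apply (cseries_ext (fun k => z ^ n * a n *
      (if Nat.leb n k then z ^ (k - n) * b (k - n)%nat else RtoC 0))%C).
    + intros k; unfold u; destruct (Nat.leb_spec n k) as [L|L]; [|ring].
      replace (z ^ k)%C with (z ^ n * z ^ (k - n))%C
        by (rewrite <- Cpow_add_r; f_equal; lia); ring.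
    + apply cseries_scal, (cseries_shift (fun k => z ^ k * b k)%C).
      apply cpseries_cseries, HG, Hz.
  - apply (cseries_ext (fun n => G z * (z ^ n * a n))%C); [intros; ring|].
    rewrite Cmult_comm; apply cseries_scal, cpseries_cseries, HF, Hz.
Qed.

Lemma taylor_pow_scal (p : C) F (a : nat -> C) n :
  is_taylor F a -> exists b, is_taylor (fun z => (p * F z) ^ n)%C b.
Proof.
  intros Ha; induction n as [|n [b Hb]].
  - exists (const_coef 1); apply taylor_const.
  - eexists; exact (taylor_mult _ _ _ _ (taylor_scal _ p _ Ha) Hb).
Qed.

Lemma taylor_csum (Fs : nat -> C -> C) N :
  (forall n, exists b, is_taylor (Fs n) b) ->
  exists b, is_taylor (fun z => csum (fun n => Fs n z) N) b.
Proof.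
  intros H; induction N as [|N [b Hb]].
  - destruct (H 0%nat) as [b Hb]; exists b.
    apply (is_taylor_ext (Fs 0%nat)); [|exact Hb].
    intros z _; now rewrite csum_0.
  - destruct (H (S N)) as [b' Hb']; eexists.
    apply (is_taylor_ext (fun z => csum (fun n => Fs n z) N + Fs (S N) z)%C).
    + intros z _; now rewrite csum_S.
    + exact (taylor_plus _ _ _ _ Hb Hb').
Qed.

(** Coefficients that are Cauchy uniformly in the index converge uniformly in
    the index to some [c], and a uniform error [e N] in the coefficients is an
    error of at most [e N / (1 - |z|)] at [z].  So the series of [c] sums to
    the pointwise limit. *)
Lemma taylor_limit (Fs : nat -> C -> C) (cs : nat -> nat -> C) F (e : nat -> R) :
  (forall N, is_taylor (Fs N) (cs N)) -> is_lim_seq e 0 ->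
  (forall N M m, (N <= M)%nat -> Cmod (cs M m - cs N m) <= e N) ->
  (forall z, in_disc z -> is_lim_seq (fun N => Cmod (Fs N z - F z)) 0) ->
  exists c, is_taylor F c /\ forall m, is_lim_seq (fun N => Cmod (cs N m - c m)) 0.
Proof.
  intros HFs He Hc HF.
  assert (L : forall m, exists l, is_lim_seq (fun N => Cmod (cs N m - l)) 0)
    by (intros m; apply (complex_cauchy_lim (fun N => cs N m) e); auto).
  pose (c := fun m => proj1_sig (constructive_indefinite_description _ (L m))).
  assert (Lc : forall m, is_lim_seq (fun N => Cmod (cs N m - c m)) 0)
    by (intros m; apply (proj2_sig (constructive_indefinite_description _ (L m)))).
  exists c; split; [|exact Lc].
  assert (D : forall N m, Cmod (c m - cs N m) <= e N).
  { intros N m; apply (le_add_lim0 _ _ _ N (Lc m)); intros M HM.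
    replace (c m - cs N m)%C with ((cs M m - cs N m) + - (cs M m - c m))%C by ring.
    eapply Rle_trans; [apply Cmod_triangle|]; rewrite Cmod_opp.
    apply Rplus_le_compat_r, Hc, HM. }
  intros z Hz.
  assert (z01 : 0 <= Cmod z < 1) by (split; [apply Cmod_ge_0 | exact Hz]).
  destruct (cpseries_ex c z) as [g Hg].
  { apply (ex_series_le_pos _ (fun n => Cmod (cs 0%nat n) * Cmod z ^ n + e 0%nat * Cmod z ^ n)).
    - intros n; assert (P : 0 <= Cmod z ^ n) by (apply pow_le; lra).
      split; [apply Rmult_le_pos; auto; apply Cmod_ge_0|].
      rewrite <- Rmult_plus_distr_r; apply Rmult_le_compat_r; auto.
      replace (c n) with (cs 0%nat n + (c n - cs 0%nat n))%C by ring.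
      eapply Rle_trans; [apply Cmod_triangle|]; specialize (D 0%nat n); lra.
    - apply (@ex_series_plus R_AbsRing R_NormedModule).
      + exact (taylor_abs_conv _ _ _ (HFs 0%nat) z01).
      + now apply ex_series_scaled_geom. }
  replace (F z) with g; [exact Hg|].
  assert (B : forall N, Cmod (g - Fs N z) <= e N / (1 - Cmod z)).
  { intros N; destruct (ex_series_scaled_geom (e N) (Cmod z) z01) as [E <-].
    apply (cseries_norm_le (fun m => z ^ m * (c m - cs N m))%C); auto.
    - intros m; rewrite Cmod_mult, Cmod_pow, Rmult_comm.
      apply Rmult_le_compat_r; [apply pow_le; lra | apply D].
    - apply cpseries_cseries, cpseries_minus; [exact Hg | apply HFs, Hz]. }
  assert (Z : (g - F z)%C = RtoC 0).
  { apply Cmod_le_0.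
    assert (He' : is_lim_seq (fun N => e N / (1 - Cmod z)) 0).
    { replace (Finite 0) with (Rbar_mult 0 (/ (1 - Cmod z))) by (simpl; f_equal; ring).
      now apply is_lim_seq_scal_r. }
    apply (le_add_lim0 _ _ _ 0 (is_lim_seq_plus0 _ _ He' (HF z Hz))).
    intros N _; rewrite Rplus_0_l.
    replace (g - F z)%C with ((g - Fs N z) + (Fs N z - F z))%C by ring.
    eapply Rle_trans; [apply Cmod_triangle | apply Rplus_le_compat_r, B]. }
  replace g with ((g - F z) + F z)%C by ring; rewrite Z; ring.
Qed.

(** * Domination on the disc *)

Lemma bernoulli_le e n : 0 <= e <= 1 -> 1 - INR n * e <= (1 - e) ^ n.
Proof.
  intros He; induction n as [|n IH]; [simpl; lra|].
  rewrite S_INR; simpl; pose proof (pos_INR n).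
  assert (0 <= (1 - e) ^ n) by (apply pow_le; lra).
  assert ((1 - e) * (1 - INR n * e) <= (1 - e) * (1 - e) ^ n)
    by (apply Rmult_le_compat_l; lra).
  nra.
Qed.

Lemma is_lim_seq_scal_inv_S K : is_lim_seq (fun j => K * / INR (S j)) 0.
Proof.
  replace (Finite 0) with (Rbar_mult K 0) by (simpl; f_equal; ring).
  apply is_lim_seq_scal_l.
  apply (is_lim_seq_incr_1 (fun j => / INR j)).
  replace (Finite 0) with (Rbar_inv p_infty) by reflexivity.
  apply is_lim_seq_inv; [apply is_lim_seq_INR | discriminate].
Qed.

(** The comparison holds on every circle of radius [r < 1].  For the first [M]
    terms the weights [r^(2 n)] are at least [r^(2 M)], which tends to 1 as
    [r] does. *)
Lemma disc_domination F H (c h : nat -> C) :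
  is_taylor F c -> is_taylor H h ->
  (forall z, in_disc z -> Cmod (F z) <= Cmod (H z)) ->
  ex_series (fun n => Cmod (h n) ^ 2) ->
  ex_series (fun n => Cmod (c n) ^ 2) /\
  Series (fun n => Cmod (c n) ^ 2) <= Series (fun n => Cmod (h n) ^ 2).
Proof.
  intros HF HH D E.
  apply ex_series_bounded; auto using pow2_ge_0; intros M.
  set (S0 := rsum (fun n => Cmod (c n) ^ 2) M).
  set (B := Series (fun n => Cmod (h n) ^ 2)).
  assert (S0pos : 0 <= S0) by (apply rsum_ge0; auto using pow2_ge_0).
  assert (Q : forall r, 0 <= r < 1 -> r ^ (2 * M) * S0 <= B).
  { intros r Hr.
    pose proof (scaled_circle_domination c h r M (proj1 Hr)
      (taylor_abs_conv F c r HF Hr) (taylor_abs_conv H h r HH Hr)) as L.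
    assert (P1 : forall n, 0 <= r ^ n <= 1).
    { intros n; split; [apply pow_le; lra|].
      rewrite <- (pow1 n); apply pow_incr; lra. }
    eapply Rle_trans; [|eapply Rle_trans; [apply L|]].
    - unfold S0; rewrite <- rsum_scal; apply rsum_le; intros n Hn.
      rewrite Rpow_mult_distr, Rmult_comm; apply Rmult_le_compat_l; [apply pow2_ge_0|].
      rewrite pow_mult, <- pow_mult, Nat.mul_comm, pow_mult.
      apply pow_incr; split; [apply P1|].
      replace M with (n + (M - n))%nat by lia; rewrite pow_add.
      pose proof (P1 n); pose proof (P1 (M - n)%nat); nra.
    - intros z F' H' Hz HF' HH'.
      assert (Dz : in_disc z) by (unfold in_disc; lra).
      rewrite (cseries_unique _ _ _ HF' (HF z Dz)), (cseries_unique _ _ _ HH' (HH z Dz)).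
      auto.
    - apply Series_le; [|exact E].
      intros n; split; [apply pow2_ge_0|].
      apply pow_incr; pose proof (P1 n); pose proof (Cmod_ge_0 (h n)).
      split; nra. }
  (* take [r = 1 - 1 / (j + 1)] and bound [r^(2 M)] below by Bernoulli *)
  apply (le_add_lim0 _ _ _ 0 (is_lim_seq_scal_inv_S (INR (2 * M) * S0))).
  intros j _.
  assert (J : 0 < / INR (S j) <= 1).
  { assert (1 <= INR (S j)) by (rewrite S_INR; pose proof (pos_INR j); lra).
    split; [apply Rinv_0_lt_compat; lra|].
    rewrite <- Rinv_1; apply Rinv_le_contravar; lra. }
  specialize (Q (1 - / INR (S j))).
  pose proof (bernoulli_le (/ INR (S j)) (2 * M)).
  assert (1 - INR (2 * M) * / INR (S j) <= (1 - / INR (S j)) ^ (2 * M)) by (apply H0; lra).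
  assert ((1 - / INR (S j)) ^ (2 * M) * S0 <= B) by (apply Q; lra).
  nra.
Qed.

(** Domination by the constant [K], now on the whole disc. *)
Lemma taylor_coef_le F (c : nat -> C) K m :
  is_taylor F c -> 0 <= K -> (forall z, in_disc z -> Cmod (F z) <= K) -> Cmod (c m) <= K.
Proof.
  intros HF HK B.
  destruct (const_coef_sums (RtoC K)) as (_ & E & S2).
  rewrite Cmod_RtoC_pos in S2 by exact HK.
  destruct (disc_domination F _ c _ HF (taylor_const (RtoC K))) as [Ec Sc]; auto.
  { intros z Hz; rewrite Cmod_RtoC_pos; auto. }
  pose proof (term_le_Series _ m (fun n => pow2_ge_0 (Cmod (c n))) Ec).
  apply Rsqr_incr_0_var; unfold Rsqr; simpl in *; lra.
Qed.

(** * Reciprocals and automorphisms of the disc *)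

Lemma one_minus_neq_0 q : Cmod q < 1 -> (1 - q)%C <> RtoC 0.
Proof.
  intros H E.
  assert (E' : q = RtoC 1) by (replace q with (1 - (1 - q))%C by ring; rewrite E; ring).
  rewrite E', Cmod_1 in H; lra.
Qed.

Lemma complex_geom q : Cmod q < 1 -> cseries (fun n => q ^ n)%C (/ (1 - q))%C.
Proof.
  intros H; pose proof (one_minus_neq_0 q H) as D; apply cseries_lim.
  assert (T : forall n, csum (fun k => q ^ k)%C n = ((1 - q ^ S n) / (1 - q))%C).
  { induction n as [|n IH]; [rewrite csum_0; simpl; Cfield; exact D|].
    rewrite csum_S, IH, !Cpow_S; Cfield; exact D. }
  apply (is_lim_seq_ext (fun n => Cmod q / Cmod (1 - q) * Cmod q ^ n)).
  - intros n; rewrite T.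
    replace ((1 - q ^ S n) / (1 - q) - / (1 - q))%C with (- (q ^ S n / (1 - q)))%C
      by (field; exact D).
    rewrite Cmod_opp, Cmod_div, Cmod_pow by exact D; simpl.
    field; intros Z; apply D, Cmod_eq_0, Z.
  - replace (Finite 0) with (Rbar_mult (Cmod q / Cmod (1 - q)) 0) by (simpl; f_equal; ring).
    apply is_lim_seq_scal_l, is_lim_seq_geom.
    rewrite Rabs_pos_eq; [exact H | apply Cmod_ge_0].
Qed.

Lemma Cmod_conj_mult a z : Cmod (Cconj a * z) = Cmod a * Cmod z.
Proof. now rewrite Cmod_mult, Cmod_conj. Qed.

Lemma conj_mult_lt_1 a z : in_disc a -> in_disc z -> Cmod (Cconj a * z) < 1.
Proof.
  unfold in_disc; intros Ha Hz; rewrite Cmod_conj_mult.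
  pose proof (Cmod_ge_0 a); pose proof (Cmod_ge_0 z); nra.
Qed.

(** The Neumann series converges uniformly on the disc because [|conj a * F|
    <= |a| < 1]; by [taylor_coef_le] the coefficients of its partial sums are
    then uniformly Cauchy. *)
Lemma taylor_reciprocal F (p : nat -> C) (a : C) :
  is_taylor F p -> (forall z, in_disc z -> in_disc (F z)) -> in_disc a ->
  exists c, is_taylor (fun z => / (1 - Cconj a * F z))%C c.
Proof.
  intros HF Hd Ha; pose proof (Cmod_ge_0 a) as a0; unfold in_disc in Ha.
  pose (Fs := fun N z => csum (fun n => (Cconj a * F z) ^ n)%C N).
  assert (HFs : forall N, exists b, is_taylor (Fs N) b).
  { intros N; apply (taylor_csum (fun n z => (Cconj a * F z) ^ n)%C); intros n.
    now apply (taylor_pow_scal _ _ p). }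
  pose (cs := fun N => proj1_sig (constructive_indefinite_description _ (HFs N))).
  assert (Hcs : forall N, is_taylor (Fs N) (cs N))
    by (intros N; apply (proj2_sig (constructive_indefinite_description _ (HFs N)))).
  pose (v := fun n => 1 * Cmod a ^ n).
  assert (Ev : ex_series v) by (apply ex_series_scaled_geom; lra).
  assert (v0 : forall n, 0 <= v n)
    by (intros n; unfold v; pose proof (pow_le _ n a0); lra).
  assert (B : forall z n, in_disc z -> Cmod ((Cconj a * F z) ^ n) <= v n).
  { intros z n Hz; unfold v; rewrite Rmult_1_l, Cmod_pow, Cmod_conj_mult.
    specialize (Hd z Hz); unfold in_disc in Hd; pose proof (Cmod_ge_0 (F z)).
    apply pow_incr; split; [nra|].
    rewrite <- (Rmult_1_r (Cmod a)) at 2; apply Rmult_le_compat_l; lra. }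
  assert (G : forall z, in_disc z ->
    cseries (fun n => (Cconj a * F z) ^ n)%C (/ (1 - Cconj a * F z))%C).
  { intros z Hz; apply complex_geom, conj_mult_lt_1; auto. }
  destruct (taylor_limit Fs cs (fun z => / (1 - Cconj a * F z))%C
              (fun N => (Series v - rsum v N) + (Series v - rsum v N)))
    as (c & Hc & _); [exact Hcs | | | |now exists c].
  - now apply is_lim_seq_plus0; apply Series_tail_lim0.
  - intros N M m HNM.
    assert (mono : rsum v N <= rsum v M) by (now apply rsum_incr).
    assert (Le : rsum v M <= Series v) by (now apply rsum_le_Series).
    apply (taylor_coef_le (fun z => Fs M z - Fs N z)%C (fun m => cs M m - cs N m)%C).
    + apply taylor_minus; apply Hcs.
    + lra.
    + intros z Hz.
      assert (T : forall K, Cmod (Fs K z - / (1 - Cconj a * F z)) <= Series v - rsum v K)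
        by (intros K; exact (cseries_tail_le _ v _ K v0 (fun n _ => B z n Hz) Ev (G z Hz))).
      pose proof (T M); pose proof (T N).
      replace (Fs M z - Fs N z)%C
        with ((Fs M z - / (1 - Cconj a * F z)) + - (Fs N z - / (1 - Cconj a * F z)))%C
        by ring.
      eapply Rle_trans; [apply Cmod_triangle|]; rewrite Cmod_opp; lra.
  - intros z Hz; now apply cseries_lim, G.
Qed.

Definition mobius (a z : C) : C := ((a - z) / (1 - Cconj a * z))%C.

Lemma mobius_denom a z : in_disc a -> in_disc z -> (1 - Cconj a * z)%C <> RtoC 0.
Proof. intros Ha Hz; apply one_minus_neq_0, conj_mult_lt_1; auto. Qed.

Lemma mobius_self a : mobius a a = RtoC 0.
Proof. unfold mobius; replace (a - a)%C with (RtoC 0) by ring; apply Cmult_0_l. Qed.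

(** The identity [|1 - conj a z|^2 - |a - z|^2 = (1 - |a|^2) (1 - |z|^2)]. *)
Lemma mobius_disc a z : in_disc a -> in_disc z -> in_disc (mobius a z).
Proof.
  intros Ha Hz; pose proof (mobius_denom a z Ha Hz) as D.
  unfold in_disc, mobius in *; rewrite Cmod_div by exact D.
  apply Cmod_gt_0 in D.
  apply (Rmult_lt_reg_r (Cmod (1 - Cconj a * z))); [exact D|].
  replace (Cmod (a - z) / Cmod (1 - Cconj a * z) * Cmod (1 - Cconj a * z))
    with (Cmod (a - z)) by (field; lra).
  rewrite Rmult_1_l; apply Rsqr_incrst_0; try apply Cmod_ge_0; rewrite !Rsqr_pow2.
  assert (E : Cmod (1 - Cconj a * z) ^ 2 - Cmod (a - z) ^ 2
              = (1 - Cmod a ^ 2) * (1 - Cmod z ^ 2))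
    by (rewrite !Cmod_sqr; simpl; ring).
  pose proof (Cmod_ge_0 a); pose proof (Cmod_ge_0 z).
  assert (0 < (1 - Cmod a ^ 2) * (1 - Cmod z ^ 2)) by (apply Rmult_lt_0_compat; nra).
  lra.
Qed.

Lemma one_minus_conj_self a :
  (1 - Cconj a * a)%C = RtoC (1 - Cmod a ^ 2).
Proof. rewrite RtoC_minus, Cmod2_conj; ring. Qed.

Lemma one_minus_conj_mobius a z : in_disc a -> in_disc z ->
  (1 - Cconj a * mobius a z)%C = (RtoC (1 - Cmod a ^ 2) / (1 - Cconj a * z))%C.
Proof.
  intros Ha Hz; rewrite <- one_minus_conj_self; unfold mobius.
  field; now apply mobius_denom.
Qed.

Lemma one_minus_sqr_neq_0 a : in_disc a -> RtoC (1 - Cmod a ^ 2) <> RtoC 0.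
Proof.
  unfold in_disc; intros Ha E; apply RtoC_inj in E; pose proof (Cmod_ge_0 a); nra.
Qed.

Lemma mobius_involutive a z : in_disc a -> in_disc z -> mobius a (mobius a z) = z.
Proof.
  intros Ha Hz; unfold mobius at 1; rewrite one_minus_conj_mobius by assumption.
  pose proof (mobius_denom a z Ha Hz) as D; pose proof (one_minus_sqr_neq_0 a Ha) as D'.
  rewrite <- one_minus_conj_self in *; unfold mobius; field; auto.
Qed.

Lemma taylor_mobius F (p : nat -> C) a :
  is_taylor F p -> (forall z, in_disc z -> in_disc (F z)) -> in_disc a ->
  exists t, is_taylor (fun z => mobius a (F z)) t.
Proof.
  intros HF Hd Ha; destruct (taylor_reciprocal F p a HF Hd Ha) as [r Hr].
  eexists; exact (taylor_mult _ _ _ _ (taylor_minus _ _ _ _ (taylor_const a) HF) Hr).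
Qed.

(** * Bounds in the Hardy space *)

(** [B] bounds the square of the norm.  The coefficients are existentially
    quantified, which spares the proofs the particular choice made in
    [H2_norm]. *)
Definition H2_bound (f : C -> C) (B : R) : Prop :=
  exists a, is_taylor f a /\ ex_series (fun n => Cmod (a n) ^ 2) /\
    Series (fun n => Cmod (a n) ^ 2) <= B.

Lemma H2_bound_ext f g B : eq_on_disc f g -> H2_bound f B -> H2_bound g B.
Proof.
  intros E (a & Ha & Q); exists a; split; [now apply (is_taylor_ext f) | exact Q].
Qed.

(** The product is dominated by [K * h]. *)
Lemma H2_bound_mult g h (b : nat -> C) K B :
  is_taylor g b -> 0 <= K -> (forall z, in_disc z -> Cmod (g z) <= K) ->
  H2_bound h B -> H2_bound (fun z => g z * h z)%C (K ^ 2 * B).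
Proof.
  intros Hg HK Bg (a & Ha & E & S).
  eexists; split; [exact (taylor_mult _ _ _ _ Hg Ha)|].
  assert (EK : forall n, Cmod (RtoC K * a n) ^ 2 = K ^ 2 * Cmod (a n) ^ 2).
  { intros n; rewrite Cmod_mult, Cmod_RtoC_pos by exact HK; ring. }
  destruct (disc_domination _ _ _ _ (taylor_mult _ _ _ _ Hg Ha)
              (taylor_scal _ (RtoC K) _ Ha)) as [E' S'].
  - intros z Hz; rewrite !Cmod_mult, Cmod_RtoC_pos by exact HK.
    apply Rmult_le_compat_r; [apply Cmod_ge_0 | auto].
  - apply (ex_series_ext (fun n => K ^ 2 * Cmod (a n) ^ 2)); [intros n; now rewrite EK|].
    now apply (@ex_series_scal R_AbsRing R_NormedModule).
  - split; [exact E'|]; eapply Rle_trans; [exact S'|].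
    rewrite (Series_ext _ _ EK), Series_scal_l.
    apply Rmult_le_compat_l; [apply pow2_ge_0 | exact S].
Qed.

Lemma taylor_coef_eq f (a : nat -> C) :
  is_taylor f a -> forall n, taylor_coef f n = a n.
Proof.
  intros H; apply (taylor_unique f); [|exact H].
  unfold taylor_coef; apply epsilon_spec; now exists a.
Qed.

Lemma H2_norm_sqr f (a : nat -> C) : is_taylor f a ->
  H2_norm f = sqrt (Series (fun n => Cmod (a n) ^ 2)).
Proof.
  intros H; unfold H2_norm; f_equal; apply Series_ext; intros n.
  now rewrite (taylor_coef_eq f a H).
Qed.

Lemma in_H2_bound f : in_H2 f -> H2_bound f (H2_norm f ^ 2).
Proof.
  intros (a & Ha & E); exists a; split; [exact Ha | split; [exact E|]].
  rewrite (H2_norm_sqr f a Ha), pow2_sqrt; [lra|].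
  apply Series_ge0; auto using pow2_ge_0.
Qed.

Lemma H2_bound_norm f B : H2_bound f (B ^ 2) -> 0 <= B -> in_H2 f /\ H2_norm f <= B.
Proof.
  intros (a & Ha & E & S) HB; split; [now exists a|].
  rewrite (H2_norm_sqr f a Ha), <- (sqrt_pow2 B) by exact HB.
  now apply sqrt_le_1_alt.
Qed.

(** * The normalised reproducing kernel *)

Definition kernel_weight (w : C) : R := sqrt (1 - Cmod w ^ 2).

Definition unit_kernel (w z : C) : C := (RtoC (kernel_weight w) / (1 - Cconj w * z))%C.

Lemma kernel_weight_sqr w : in_disc w ->
  0 < kernel_weight w /\ kernel_weight w ^ 2 = 1 - Cmod w ^ 2.
Proof.
  unfold in_disc; intros H; pose proof (Cmod_ge_0 w).
  assert (0 < 1 - Cmod w ^ 2) by nra.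
  split; [now apply sqrt_lt_R0 | apply pow2_sqrt; lra].
Qed.

(** The coefficients of [unit_kernel w]. *)
Definition kernel_coef (w : C) (n : nat) : C := (RtoC (kernel_weight w) * Cconj w ^ n)%C.

Lemma taylor_unit_kernel w : in_disc w -> is_taylor (unit_kernel w) (kernel_coef w).
Proof.
  intros Hw z Hz; apply cpseries_cseries; unfold unit_kernel, kernel_coef, Cdiv.
  apply (cseries_ext (fun n => RtoC (kernel_weight w) * (Cconj w * z) ^ n)%C).
  - intros n; rewrite Cpow_mult_l; ring.
  - apply cseries_scal, complex_geom, conj_mult_lt_1; auto.
Qed.

Lemma kernel_coef_norm w : in_disc w -> is_series (fun n => Cmod (kernel_coef w n) ^ 2) 1.
Proof.
  intros Hw; destruct (kernel_weight_sqr w Hw) as [k0 k2].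
  unfold in_disc in Hw; pose proof (Cmod_ge_0 w).
  assert (q : 0 <= Cmod w ^ 2 < 1) by nra.
  destruct (ex_series_scaled_geom (kernel_weight w ^ 2) _ q) as [E S].
  apply (is_series_ext (fun n => kernel_weight w ^ 2 * (Cmod w ^ 2) ^ n)).
  - intros n; unfold kernel_coef.
    rewrite Cmod_mult, Cmod_RtoC_pos, Cmod_pow, Cmod_conj by lra.
    now rewrite Rpow_mult_distr, <- !pow_mult, (Nat.mul_comm n).
  - assert (S1 : Series (fun n => kernel_weight w ^ 2 * (Cmod w ^ 2) ^ n) = 1)
      by (rewrite S, k2; field; lra).
    rewrite <- S1; exact (Series_correct _ E).
Qed.

Lemma Cmod_plus_sqr x y :
  Cmod (x + y) ^ 2 = Cmod x ^ 2 + Cmod y ^ 2 + 2 * Re (Cconj x * y).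
Proof. rewrite !Cmod_sqr; unfold Re; simpl; ring. Qed.

Lemma Re_RtoC_mult r x : Re (RtoC r * x) = r * Re x.
Proof. unfold Re, Cmult, RtoC; simpl; ring. Qed.

Lemma cseries_Re (u : nat -> C) (l : C) :
  cseries u l -> is_series (fun n => Re (u n)) (Re l).
Proof.
  intros H; apply cseries_lim in H.
  change (is_lim_seq (rsum (fun n => Re (u n))) (Re l)).
  assert (E : forall n, rsum (fun n => Re (u n)) n = Re (csum u n)).
  { induction n as [|n IH]; [now rewrite rsum_0, csum_0|].
    now rewrite rsum_S, csum_S, IH. }
  assert (Z : is_lim_seq (fun n => Re (csum u n) - Re l) 0).
  { apply is_lim_seq_abs_0.
    apply (is_lim_seq_0_squeeze _ (fun n => Cmod (csum u n - l))); [|exact H].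
    intros n; split; [apply Rabs_pos|].
    change (Re (csum u n) - Re l) with (fst (csum u n - l)%C).
    eapply Rle_trans; [apply Rmax_l | apply Rmax_Cmod]. }
  apply (is_lim_seq_ext (fun n => (Re (csum u n) - Re l) + Re l)).
  - intros n; rewrite E; ring.
  - replace (Finite (Re l)) with (Finite (0 + Re l)) by (f_equal; ring).
    apply is_lim_seq_plus'; [exact Z | apply is_lim_seq_const].
Qed.

(** [unit_kernel w] has norm 1, and by the reproducing property its inner
    product with [G] is a multiple of [G w = 0]. *)
Lemma kernel_pythagoras w G (g : nat -> C) (c : C) :
  in_disc w -> is_taylor G g -> G w = RtoC 0 -> ex_series (fun n => Cmod (g n) ^ 2) ->
  is_series (fun n => Cmod (c * kernel_coef w n + g n) ^ 2)
    (Cmod c ^ 2 + Series (fun n => Cmod (g n) ^ 2)).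
Proof.
  intros Hw HG Z E.
  assert (Orth : is_series (fun n => 2 * Re (Cconj (c * kernel_coef w n) * g n)) 0).
  { assert (H : cseries (fun n => w ^ n * g n)%C (RtoC 0)) by (rewrite <- Z; exact (HG w Hw)).
    apply (cseries_scal (Cconj c * RtoC (2 * kernel_weight w))%C) in H.
    apply cseries_Re in H.
    replace 0 with (Re (Cconj c * RtoC (2 * kernel_weight w) * 0)%C)
      by (rewrite Cmult_0_r; reflexivity).
    revert H; apply is_series_ext; intros n; cbv beta.
    replace (Cconj c * RtoC (2 * kernel_weight w) * (w ^ n * g n))%C
      with (RtoC 2 * (Cconj (c * kernel_coef w n) * g n))%C.
    - apply Re_RtoC_mult.
    - unfold kernel_coef.
      rewrite !Cmult_conj, Cconj_RtoC, Cpow_conj, Cconj_conj, RtoC_mult; ring. }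
  apply (is_series_ext (fun n => (Cmod c ^ 2 * Cmod (kernel_coef w n) ^ 2 + Cmod (g n) ^ 2)
    + 2 * Re (Cconj (c * kernel_coef w n) * g n))).
  - intros n; rewrite Cmod_plus_sqr, Cmod_mult; Rring.
  - replace (Cmod c ^ 2 + Series (fun n => Cmod (g n) ^ 2))
      with ((Cmod c ^ 2 * 1 + Series (fun n => Cmod (g n) ^ 2)) + 0) by ring.
    apply (@is_series_plus R_AbsRing R_NormedModule); [|exact Orth].
    apply (@is_series_plus R_AbsRing R_NormedModule); [|apply Series_correct, E].
    apply (@is_series_scal R_AbsRing R_NormedModule), kernel_coef_norm, Hw.
Qed.

Lemma unit_kernel_0 z : unit_kernel 0 z = RtoC 1.
Proof.
  unfold unit_kernel, kernel_weight; rewrite Cmod_0.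
  replace (1 - 0 ^ 2) with 1 by ring; rewrite sqrt_1.
  replace (1 - Cconj 0 * z)%C with (RtoC 1) by (rewrite Cconj_RtoC; ring).
  field; apply RtoC_neq; lra.
Qed.

(** In operator terms, [f |-> unit_kernel a * (f o mobius a)] is an
    involution.  Evaluated at [phi z], this is the factorisation of the
    composition with [phi]. *)
Lemma unit_kernel_factorization a f z : in_disc a -> in_disc z ->
  (unit_kernel a z *
    (unit_kernel a (mobius a z) * f (mobius a (mobius a z))))%C = f z.
Proof.
  intros Ha Hz; rewrite mobius_involutive by assumption.
  unfold unit_kernel; rewrite one_minus_conj_mobius by assumption.
  destruct (kernel_weight_sqr a Ha) as [k0 k2].
  pose proof (mobius_denom a z Ha Hz) as D; pose proof (one_minus_sqr_neq_0 a Ha) as D'.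
  rewrite <- k2 in *; rewrite RtoC_pow in *.
  assert (kn : RtoC (kernel_weight a) <> RtoC 0) by (intros E; apply RtoC_inj in E; lra).
  field; auto.
Qed.

(** The denominator is at least [1 - |a|]. *)
Lemma unit_kernel_le a z : in_disc a -> in_disc z ->
  Cmod (unit_kernel a z) <= sqrt ((1 + Cmod a) / (1 - Cmod a)).
Proof.
  intros Ha Hz; pose proof (mobius_denom a z Ha Hz) as D.
  destruct (kernel_weight_sqr a Ha) as [k0 k2].
  unfold in_disc in *; pose proof (Cmod_ge_0 a); pose proof (Cmod_ge_0 z).
  unfold unit_kernel; rewrite Cmod_div, Cmod_RtoC_pos by (exact D || lra).
  assert (L : 1 - Cmod a <= Cmod (1 - Cconj a * z)).
  { pose proof (Cmod_conj_mult a z).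
    assert (Cmod 1 <= Cmod (1 - Cconj a * z) + Cmod (Cconj a * z)).
    { replace (RtoC 1) with ((1 - Cconj a * z) + Cconj a * z)%C at 1 by ring.
      apply Cmod_triangle. }
    rewrite Cmod_1 in *; nra. }
  apply Rle_trans with (kernel_weight a / (1 - Cmod a)).
  - apply Rmult_le_compat_l; [lra | apply Rinv_le_contravar; lra].
  - rewrite <- (sqrt_pow2 (kernel_weight a / (1 - Cmod a))).
    + apply sqrt_le_1_alt; right.
      unfold Rdiv; rewrite Rpow_mult_distr, k2; field; lra.
    + apply Rmult_le_pos; [lra | apply Rlt_le, Rinv_0_lt_compat; lra].
Qed.

(** * Weighted composition operators *)

(** Induction on the degree: split off the constant term, [p = a 0 + z q].
    The image of [p] is [a 0 * unit_kernel w] plus [tau] times the image of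
    [q]; the latter vanishes at [w], so the squares of the norms add up, and
    its norm is at most that of the image of [q]. *)
Lemma weighted_composition_poly w tau (t : nat -> C) N : in_disc w -> is_taylor tau t ->
  (forall z, in_disc z -> Cmod (tau z) <= 1) -> tau w = RtoC 0 ->
  forall a : nat -> C,
  H2_bound (fun z => unit_kernel w z * csum (fun n => tau z ^ n * a n) N)%C
    (rsum (fun n => Cmod (a n) ^ 2) N).
Proof.
  intros Hw Ht Bt Zt; induction N as [|N IH]; intros a.
  - assert (HP := kernel_pythagoras w (fun _ => RtoC 0) (const_coef 0) (a 0%nat) Hw
      (taylor_const 0) eq_refl).
    destruct (const_coef_sums 0) as (_ & E0 & S0).
    specialize (HP E0); rewrite Cmod_0 in S0.
    eexists; split; [|split; [eexists; exact HP|]].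
    + eapply is_taylor_ext; [|exact (taylor_plus _ _ _ _
        (taylor_scal _ (a 0%nat) _ (taylor_unit_kernel w Hw)) (taylor_const 0))].
      intros z _; rewrite csum_0; simpl; ring.
    + eapply Rle_trans; [right; exact (is_series_unique _ _ HP)|].
      rewrite rsum_0; lra.
  - destruct (IH (fun n => a (S n))) as (g & Hg & Eg & Sg).
    destruct (H2_bound_mult tau _ t 1 _ Ht Rle_0_1 Bt
      (ex_intro _ g (conj Hg (conj Eg Sg)))) as (g' & Hg' & Eg' & Sg').
    assert (HP := kernel_pythagoras w _ g' (a 0%nat) Hw Hg').
    cbv beta in HP; rewrite Zt, Cmult_0_l in HP; specialize (HP eq_refl Eg').
    eexists; split; [|split; [eexists; exact HP|]].
    + eapply is_taylor_ext; [|exact (taylor_plus _ _ _ _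
        (taylor_scal _ (a 0%nat) _ (taylor_unit_kernel w Hw)) Hg')].
      intros z _; rewrite csum_S_l.
      rewrite (csum_ext (fun k => tau z ^ S k * a (S k))%C
                 (fun k => tau z * (tau z ^ k * a (S k)))%C)
        by (intros; rewrite Cpow_S; ring).
      rewrite csum_scal; simpl; Cring.
    + eapply Rle_trans; [right; exact (is_series_unique _ _ HP)|].
      assert (Sp : rsum (fun n => Cmod (a n) ^ 2) (S N)
        = Cmod (a 0%nat) ^ 2 + rsum (fun n => Cmod (a (S n)) ^ 2) N).
      { apply RtoC_inj; rewrite RtoC_plus, <- !csum_RtoC; apply csum_S_l. }
      rewrite Sp; lra.
Qed.

(** Fatou's lemma for finite sums of squares. *)
Lemma sum_sqr_le_of_limit (x : nat -> nat -> C) (c : nat -> C) B L :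
  (forall m, is_lim_seq (fun N => Cmod (x N m - c m)) 0) ->
  (forall N, rsum (fun m => Cmod (x N m) ^ 2) L <= B) ->
  rsum (fun m => Cmod (c m) ^ 2) L <= B.
Proof.
  intros H HB.
  assert (P : forall m, is_lim_seq (fun N => Cmod (x N m) ^ 2) (Cmod (c m) ^ 2)).
  { intros m.
    assert (Q : is_lim_seq (fun N => Cmod (x N m)) (Cmod (c m))).
    { apply (is_lim_seq_ext (fun N => (Cmod (x N m) - Cmod (c m)) + Cmod (c m)));
        [intros; ring|].
      replace (Finite (Cmod (c m))) with (Finite (0 + Cmod (c m))) by (f_equal; ring).
      apply is_lim_seq_plus'; [|apply is_lim_seq_const].
      apply is_lim_seq_abs_0, (is_lim_seq_0_squeeze _ _) with (2 := H m).
      intros N; split; [apply Rabs_pos|].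
      apply Rabs_le; split.
      - assert (Cmod (c m) <= Cmod (x N m) + Cmod (x N m - c m)); [|lra].
        replace (c m) with (x N m + - (x N m - c m))%C at 1 by ring.
        eapply Rle_trans; [apply Cmod_triangle|]; rewrite Cmod_opp; lra.
      - assert (Cmod (x N m) <= Cmod (c m) + Cmod (x N m - c m)); [|lra].
        replace (x N m) with (c m + (x N m - c m))%C at 1 by ring.
        apply Cmod_triangle. }
    simpl; apply is_lim_seq_mult'; [exact Q|].
    apply is_lim_seq_mult'; [exact Q | apply is_lim_seq_const]. }
  assert (S : is_lim_seq (fun N => rsum (fun m => Cmod (x N m) ^ 2) L)
                (rsum (fun m => Cmod (c m) ^ 2) L)).
  { clear HB; induction L as [|L IH].
    - rewrite rsum_0; apply (is_lim_seq_ext (fun N => Cmod (x N 0%nat) ^ 2)); auto.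
      intros N; now rewrite rsum_0.
    - rewrite rsum_S.
      apply (is_lim_seq_ext (fun N => rsum (fun m => Cmod (x N m) ^ 2) L
        + Cmod (x N (S L)) ^ 2)); [intros N; now rewrite rsum_S|].
      now apply is_lim_seq_plus'. }
  exact (is_lim_seq_le _ _ _ B HB S (is_lim_seq_const B)).
Qed.

(** Apply the polynomial case to the partial sums of the expansion of [f] and
    to their differences: the latter shows that the coefficients of the images
    are Cauchy at the rate of the tail of [f], uniformly in the index, so that
    [taylor_limit] applies. *)
Lemma weighted_composition w tau (t : nat -> C) f B : in_disc w -> is_taylor tau t ->
  (forall z, in_disc z -> in_disc (tau z)) -> tau w = RtoC 0 ->
  H2_bound f B -> H2_bound (fun z => unit_kernel w z * f (tau z))%C B.
Proof.
  intros Hw Ht Dt Zt (a & Ha & Ea & Sa).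
  assert (Bt : forall z, in_disc z -> Cmod (tau z) <= 1)
    by (intros z Hz; apply Rlt_le, Dt, Hz).
  pose (Fs := fun N z => (unit_kernel w z * csum (fun n => tau z ^ n * a n)%C N)%C).
  assert (HFs : forall N, H2_bound (Fs N) (rsum (fun n => Cmod (a n) ^ 2) N))
    by (intros N; now apply (weighted_composition_poly w tau t)).
  pose (cs := fun N => proj1_sig (constructive_indefinite_description _ (HFs N))).
  assert (Hcs : forall N, is_taylor (Fs N) (cs N) /\
    ex_series (fun n => Cmod (cs N n) ^ 2) /\
    Series (fun n => Cmod (cs N n) ^ 2) <= rsum (fun n => Cmod (a n) ^ 2) N)
    by (intros N; apply (proj2_sig (constructive_indefinite_description _ (HFs N)))).
  set (v := fun n => Cmod (a n) ^ 2) in *.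
  assert (v0 : forall n, 0 <= v n) by (intros; apply pow2_ge_0).
  destruct (taylor_limit Fs cs (fun z => unit_kernel w z * f (tau z))%C
              (fun N => sqrt (Series v - rsum v N))) as (c & Hc & Lc).
  - intros N; apply Hcs.
  - rewrite <- sqrt_0.
    apply (is_lim_seq_continuous sqrt (fun N => Series v - rsum v N) 0).
    + apply continuity_pt_sqrt; lra.
    + now apply Series_tail_lim0.
  - intros N M m HNM.
    (* the difference of the two images is the image of a truncated polynomial *)
    destruct (weighted_composition_poly w tau t M Hw Ht Bt Zt
      (fun n => if Nat.leb n N then RtoC 0 else a n)) as (g & Hg & Eg & Sg).
    assert (Split : forall K (u : nat -> C), (N <= K)%nat ->
      csum (fun n => u n * (if Nat.leb n N then RtoC 0 else a n))%C K
      = (csum (fun n => u n * a n)%C K - csum (fun n => u n * a n)%C N)%C).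
    { intros K u HK; induction HK as [|K HK IH].
      - rewrite (csum_ext _ (fun _ => RtoC 0 * RtoC 0)%C).
        + rewrite csum_scal; Cring.
        + intros k Hk; rewrite (proj2 (Nat.leb_le k N) Hk); ring.
      - rewrite !csum_S, IH, (proj2 (Nat.leb_gt (S K) N)) by lia; Cring. }
    assert (E : forall n, g n = (cs M n - cs N n)%C).
    { apply (taylor_unique (fun z => Fs M z - Fs N z)%C).
      - revert Hg; apply is_taylor_ext; intros z _; unfold Fs.
        rewrite Split by exact HNM; Cring.
      - apply taylor_minus; apply Hcs. }
    rewrite <- E; rewrite <- (sqrt_pow2 (Cmod (g m))) by apply Cmod_ge_0.
    apply sqrt_le_1_alt.
    eapply Rle_trans; [apply (term_le_Series (fun m => Cmod (g m) ^ 2) m);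
      auto using pow2_ge_0|].
    eapply Rle_trans; [exact Sg|].
    assert (T : rsum (fun n => Cmod (if Nat.leb n N then RtoC 0 else a n) ^ 2) M
                = rsum v M - rsum v N).
    { clear - HNM; induction HNM as [|K HK IH].
      - replace (rsum v N - rsum v N) with 0 by Rring.
        assert (Z : forall K, (K <= N)%nat ->
          rsum (fun n => Cmod (if Nat.leb n N then RtoC 0 else a n) ^ 2) K = 0).
        { induction K as [|K IH]; intros HK.
          - rewrite rsum_0; simpl Nat.leb; cbv iota; rewrite Cmod_0; Rring.
          - rewrite rsum_S, IH, (proj2 (Nat.leb_le (S K) N) HK), Cmod_0 by lia; Rring. }
        now apply Z.
      - rewrite !rsum_S, IH, (proj2 (Nat.leb_gt (S K) N)) by lia.
        change (v (S K)) with (Cmod (a (S K)) ^ 2); Rring. }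
    rewrite T; apply Rplus_le_compat_r, rsum_le_Series; auto.
  - intros z Hz; unfold Fs.
    pose proof (proj1 (cseries_lim _ _) (proj1 (cpseries_cseries _ _ _) (Ha _ (Dt z Hz)))) as L.
    apply (is_lim_seq_scal_l _ (Cmod (unit_kernel w z))) in L.
    simpl in L; rewrite Rmult_0_r in L.
    revert L; apply is_lim_seq_ext; intros N; rewrite <- Cmod_mult; f_equal; ring.
  - exists c; split; [exact Hc|].
    apply ex_series_bounded; auto using pow2_ge_0; intros L.
    apply (sum_sqr_le_of_limit cs c B L Lc); intros N.
    destruct (Hcs N) as (_ & E & S).
    eapply Rle_trans; [apply (rsum_le_Series (fun m => Cmod (cs N m) ^ 2));
      auto using pow2_ge_0|].
    eapply Rle_trans; [exact S|]; eapply Rle_trans; [apply rsum_le_Series|]; auto.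
Qed.

(** * Composition operators *)

(** Two contractions followed by a multiplication.  [weighted_composition] is
    used at [a] with [mobius a], and at 0, where the kernel is 1, with [mobius
    a o phi]. *)
Lemma composition_bound phi (p : nat -> C) K f B :
  is_taylor phi p -> (forall z, in_disc z -> in_disc (phi z)) -> 0 <= K ->
  (forall z, in_disc z -> Cmod (unit_kernel (phi 0) (phi z)) <= K) ->
  H2_bound f B -> H2_bound (composition_op phi f) (K ^ 2 * B).
Proof.
  intros Hphi Hd HK Bk Hf.
  assert (D0 : in_disc 0) by (unfold in_disc; rewrite Cmod_0; lra).
  pose proof (Hd 0 D0) as Ha; set (a := phi 0) in *.
  destruct taylor_id as [i Hi].
  destruct (taylor_mobius (fun z => z) i a Hi (fun z H => H) Ha) as [t1 Ht1].
  destruct (taylor_mobius phi p a Hphi Hd Ha) as [t2 Ht2].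
  destruct (taylor_reciprocal phi p a Hphi Hd Ha) as [r Hr].
  pose proof (weighted_composition a (mobius a) t1 f B Ha Ht1
    (fun z => mobius_disc a z Ha) (mobius_self a) Hf) as H1.
  pose proof (weighted_composition 0 (fun z => mobius a (phi z)) t2 _ B D0 Ht2
    (fun z Hz => mobius_disc a _ Ha (Hd z Hz)) (mobius_self a) H1) as H2.
  apply (H2_bound_ext _ (fun z => unit_kernel a (mobius a (phi z)) *
    f (mobius a (mobius a (phi z))))%C) in H2.
  2:{ intros z _; rewrite unit_kernel_0; apply Cmult_1_l. }
  apply (H2_bound_ext (fun z => unit_kernel a (phi z) *
    (unit_kernel a (mobius a (phi z)) * f (mobius a (mobius a (phi z)))))%C).
  - intros z Hz; apply (unit_kernel_factorization a f (phi z)); auto.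
  - exact (H2_bound_mult _ _ _ K B
      (taylor_scal _ (RtoC (kernel_weight a)) _ Hr) HK Bk H2).
Qed.

Theorem theorem2p1 (phi : C -> C)
  (phi_analytic : analytic_on_disc phi)
  (phi_disc : forall z : C, in_disc z -> in_disc (phi z)) :
  bounded_linear_on_H2 (composition_op phi) /\
  Rbar_le (H2_opnorm (composition_op phi))
    (sup_norm_disc (fun z : C =>
       (RtoC (sqrt (1 - Cmod (phi (RtoC 0)) ^ 2)) /
         (RtoC 1 - Cconj (phi (RtoC 0)) * phi z))%C)) /\
  Rbar_le
    (sup_norm_disc (fun z : C =>
       (RtoC (sqrt (1 - Cmod (phi (RtoC 0)) ^ 2)) /
         (RtoC 1 - Cconj (phi (RtoC 0)) * phi z))%C))
    (Finite (sqrt ((1 + Cmod (phi (RtoC 0))) / (1 - Cmod (phi (RtoC 0)))))).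
Proof.
  destruct (taylor_of_analytic phi phi_analytic) as [p Hp].
  assert (D0 : in_disc 0) by (unfold in_disc; rewrite Cmod_0; lra).
  set (a := phi (RtoC 0)).
  set (kappa := sqrt ((1 + Cmod a) / (1 - Cmod a))).
  change (fun z : C => (RtoC (sqrt (1 - Cmod a ^ 2)) / (RtoC 1 - Cconj a * phi z))%C)
    with (fun z : C => unit_kernel a (phi z)).
  assert (Ha : in_disc a) by (apply phi_disc, D0).
  assert (Bk : forall z, in_disc z -> Cmod (unit_kernel a (phi z)) <= kappa)
    by (intros z Hz; apply unit_kernel_le; auto).
  destruct (Lub_Rbar_correct (fun x => exists z, in_disc z /\
    x = Cmod (unit_kernel a (phi z)))) as [Ub Lub].
  fold (sup_norm_disc (fun z => unit_kernel a (phi z))) in Ub, Lub.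
  assert (Ls : Rbar_le (sup_norm_disc (fun z => unit_kernel a (phi z))) kappa).
  { apply Lub; intros x (z & Hz & ->); now apply Bk. }
  assert (Bd : forall K f, 0 <= K ->
    (forall z, in_disc z -> Cmod (unit_kernel a (phi z)) <= K) -> in_H2 f ->
    in_H2 (composition_op phi f) /\
    H2_norm (composition_op phi f) <= K * H2_norm f).
  { intros K f HK HB Hf; apply H2_bound_norm.
    - rewrite Rpow_mult_distr; apply (composition_bound phi p); auto.
      now apply in_H2_bound.
    - apply Rmult_le_pos; [exact HK | apply sqrt_pos]. }
  assert (k0 : 0 <= kappa) by apply sqrt_pos.
  split; [|split]; [|clear Ls|exact Ls].
  - split; [|split; [|split; [|split]]].
    + intros f Hf; now apply (Bd kappa).
    + intros f g _ _ E z Hz; apply E, phi_disc, Hz.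
    + intros f g _ _ z _; reflexivity.
    + intros c f _ z _; reflexivity.
    + exists kappa; intros f Hf; now apply Bd.
  - destruct (sup_norm_disc (fun z => unit_kernel a (phi z))) as [s| |] eqn:Es.
    + assert (Bs : forall z, in_disc z -> Cmod (unit_kernel a (phi z)) <= s)
        by (intros z Hz; apply (Ub (Cmod (unit_kernel a (phi z)))); eauto).
      assert (s0 : 0 <= s) by (eapply Rle_trans; [apply Cmod_ge_0 | apply (Bs 0 D0)]).
      apply Lub_Rbar_correct; intros x (f & Hf & Nf & ->).
      destruct (Bd s f s0 Bs Hf) as [_ L]; simpl.
      assert (0 <= H2_norm f) by apply sqrt_pos; nra.
    + now destruct (H2_opnorm (composition_op phi)).
    + destruct (Ub (Cmod (unit_kernel a (phi 0)))); eauto.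
Qed.
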